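(* For every integer $r\ge2$ and every real $2\le p<\infty$ there is a constant $C_{r,p}>0$, depending only on $r$ and $p$, such that the following holds for every integer $d\ge1$. Let $T$ be a random symmetric tensor in $(\mathbb{R}^d)^{\otimes r}$ whose entries are jointly Gaussian, with $\mathbb{E}[T]=0$. Then $$ d^{\frac1p-\frac12}\,\mathbb{E}\|T\|_{\mathcal{I}_p}\;\le\; C_{r,p}\Big( (\log d)\,\sigma_{(1,\mathcal{I}_p)}+\max_{2\le q\le r}\ \sigma_{(q,\mathcal{I}_p)}^{\frac1q}\,\sigma_{(0,\mathcal{I}_p)}^{\frac{q-1}{q}}\Big).$$
   Context: A tensor is symmetric if its entries are invariant under all permutations of the indices. For a tensor $S\in(\mathbb{R}^d)^{\otimes m}$ with $m\ge1$, the $\ell_p$ injective norm is $\|S\|_{\mathcal{I}_p}=\sup\{\langle S,x_1\otimes\cdots\otimes x_m\rangle : \|x_1\|_p,\dots,\|x_m\|_p\le1\}$, with $\langle\cdot,\cdot\rangle$ the entrywise inner product; for an order $0$ tensor (a scalar) it is the absolute value. For $A,B\in(\mathbb{R}^d)^{\otimes r}$ and $0\le q\le r$, $A\star_qB$ is the order $2r-2q$ tensor on $\mathbb{R}^d$ with entries $$(A\star_qB)_{i_1,\dots,i_{2r-2q}}=\sum_{j_1,\dots,j_q=1}^dA_{i_1,\dots,i_{r-q},j_1,\dots,j_q}\,B_{j_1,\dots,j_q,i_{r-q+1},\dots,i_{2r-2q}}$$ (for $q=0$ this is the tensor product, for $q=r$ the scalar $\langle A,B\rangle$ when $A,B$ are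 symmetric). For the random tensor $T$ and $0\le q\le r$, set $\sigma_{(q,\mathcal{I}_p)}\ge0$ with $\sigma_{(q,\mathcal{I}_p)}^2=\big\|\mathbb{E}[T\star_qT]\big\|_{\mathcal{I}_p}$. *)

(* Defs.v *)
From HB Require Import structures.
From mathcomp Require Import all_boot all_order all_fingroup all_algebra.
From mathcomp Require Import all_classical all_reals all_analysis.

Set Implicit Arguments.
Unset Strict Implicit.
Unset Printing Implicit Defensive.

Import Order.TTheory GRing.Theory Num.Theory.
Import numFieldNormedType.Exports.

Local Open Scope classical_set_scope.
Local Open Scope ring_scope.

Section Tensors.
Context {R : realType} {d : nat}.

Definition tensor (m : nat) : Type := m.-tuple 'I_d -> R.

Definition symmetric_tensor (m : nat) (S : tensor m) : Prop :=
  forall (s : 'S_m) (i : m.-tuple 'I_d), S [tuple tnth i (s k) | k < m] = S i.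

Definition inner (m : nat) (A B : tensor m) : R :=
  \sum_(i : m.-tuple 'I_d) A i * B i.

Definition pure_tensor (m : nat) (x : 'I_m -> 'rV[R]_d) : tensor m :=
  fun i => \prod_(k < m) x k 0 (tnth i k).

Definition lpnorm (p : R) (x : 'rV[R]_d) : R :=
  (\sum_(i < d) `|x 0 i| `^ p) `^ p^-1.

Definition injnorm (p : R) (m : nat) : tensor m -> R :=
  match m with
  | 0%N => fun S => `|S [tuple]|
  | m'.+1 => fun S =>
      sup [set inner S (pure_tensor x) |
            x in [set x : 'I_m'.+1 -> 'rV[R]_d | forall k, lpnorm p (x k) <= 1]]
  end.

Definition left_index (a b : nat) (i : (a + b).-tuple 'I_d) : a.-tuple 'I_d :=
  [tuple tnth i (lshift b k) | k < a].

Definition right_index (a b : nat) (i : (a + b).-tuple 'I_d) : b.-tuple 'I_d :=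
  [tuple tnth i (rshift a k) | k < b].

(* The contraction of A and B over q indices has order 2r - 2q, written
   (r - q) + (r - q); [tcast] only transports along r - q + q = r and
   q + (r - q) = r. *)
Definition star (r : nat) (q : 'I_r.+1) (A B : tensor r) :
    tensor ((r - q) + (r - q)) :=
  fun i => \sum_(j : q.-tuple 'I_d)
    A (tcast (subnK (leq_ord q)) (cat_tuple (left_index i) j)) *
    B (tcast (subnKC (leq_ord q)) (cat_tuple j (right_index i))).

End Tensors.
Arguments tensor R d m : clear implicits.
Arguments star {R d r} q A B i.

Section RandomTensors.
Context {R : realType} {disp : measure_display} {Omega : measurableType disp}
  (P : probability Omega R).

(* Constants count as Gaussian. They are treated apart because
   [normal_prob m 0] is the uniform law on [0, 1], not the Dirac mass at m. *)
Definition gaussian (X : Omega -> R) : Prop :=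
  exists m s : R, 0 <= s /\
    forall A : set R, measurable A ->
      pushforward P X A = if s == 0 then \d_m A else normal_prob m s A.

Definition jointly_gaussian (I : finType) (X : I -> {RV P >-> R}) : Prop :=
  forall c : I -> R, gaussian (fun w => \sum_(i : I) c i * X i w).

Context {d r : nat} (T : r.-tuple 'I_d -> {RV P >-> R}).

Definition sample (w : Omega) : tensor R d r := fun i => T i w.

Definition mean_star (q : 'I_r.+1) : tensor R d ((r - q) + (r - q)) :=
  fun i => fine 'E_P[fun w => star q (sample w) (sample w) i].

Definition sigma (p : R) (q : 'I_r.+1) : R :=
  Num.sqrt (injnorm p (@mean_star q)).

End RandomTensors.
Arguments gaussian {R disp Omega} P X.
Arguments jointly_gaussian {R disp Omega} P {I} X.
Arguments sample {R disp Omega P d r} T w i.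
Arguments mean_star {R disp Omega P d r} T q i.
Arguments sigma {R disp Omega P d r} T p q.

(* Main.v *)
Require Import Defs.
From HB Require Import structures.
From mathcomp Require Import all_boot all_order all_fingroup all_algebra.
From mathcomp Require Import all_classical all_reals all_analysis.
From mathcomp Require Import measurable_realfun zify ring lra.

Set Implicit Arguments.
Unset Strict Implicit.
Unset Printing Implicit Defensive.

Import Order.TTheory GRing.Theory Num.Theory.
Import numFieldNormedType.Exports.

Local Open Scope classical_set_scope.
Local Open Scope ring_scope.

(** The injective norm of [T] is the supremum of the Gaussian process
    [<T, x_1 * ... * x_r>] over [r]-tuples of points of the l_p ball, which is bounded
    by chaining over dyadic scales.  At scale [e] a separated set is counted by a
    volumetric argument: the points [x_k] are perturbed by independent centred noise of
    standard deviation [t] per coordinate, so that expanding the product over subsets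
    [S] of slots bounds the mean squared increment by a multiple of
    [sum_(S <> 0) t^(2|S|) sigma_|S|^2].  The noise is a normalised sum of biased signs;
    its law has chi-square density at most [exp (|x|^2 / t^2)] with respect to unbiased
    signs whatever [x] is, hence a separated set has at most
    [4 exp (r d^(1-2/p) / t^2)] elements with [t] of order [min_q (e / sigma_q)^(1/q)].
    Summing [e (sigma_q / e)^(1/q)] over dyadic [e] between [sigma_0 / d] and [sigma_0]
    gives a geometric series for [q >= 2] and [log d] equal terms for [q = 1]; below
    that range a crude grid net suffices. *)

(** * Gaussian moments *)

(** The parameters [sigma_q] arise as follows. Independent noise of covariance [t^2] times the
    identity in the slots of [S] averages the covariance form into [t^(2|S|)] times its trace over
    these slots. Symmetry of the tensor moves [S] to the last positions, where this trace is the
    value of E[T star_q T], with q = |S|, at the pure tensor formed by the remaining vectors, each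
    taken twice; the injective norm bounds it. The noisy points may leave the l_p ball. This is
    harmless, because the volume comparison takes place under one reference law on a finite set, and
    its chi-square cost sees a point only through its Euclidean norm. On the l_p ball that norm is
    at most [d^(1/2-1/p)], whose inverse is the prefactor in the theorem. Signs in place of Gaussian
    noise keep the comparison within finite sums. The only Gaussian input to the chaining is that a
    centred Gaussian variable has moment generating function at most that given by its variance. *)

Lemma ge0_integral_normal_prob (R : realType) (m s : R) (f : _ -> \bar R) :
  measurable_fun setT f -> (forall x, 0 <= f x)%E ->
  (\int[normal_prob m s]_x f x =
   \int[lebesgue_measure]_x (f x * (normal_pdf m s x)%:E))%E.
Proof.
move=> mf f0.
have dom := @normal_prob_dominates R m s.
rewrite -(Radon_Nikodym_SigmaFinite.change_of_variables dom f0 measurableT mf).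
have mg : measurable_fun setT (fun x => (normal_pdf m s x)%:E).
  by apply/measurable_EFinP; exact: measurable_normal_pdf.
have intg := Radon_Nikodym_SigmaFinite.f_integrable dom.
apply: ae_eq_integral => //.
- by apply: emeasurable_funM => //; exact: measurable_int intg.
- exact: emeasurable_funM.
have H : ae_eq lebesgue_measure setT
    (Radon_Nikodym_SigmaFinite.f (normal_prob m s) lebesgue_measure)
    (fun x => (normal_pdf m s x)%:E).
  apply: integral_ae_eq => //.
  by move=> E _ mE; rewrite -(Radon_Nikodym_SigmaFinite.f_integral dom).
by apply: filterS H => x /= H Tx; rewrite H.
Qed.

(** Completing the square: exponential tilting only shifts the mean, so the moment generating
    function reduces to the total mass of a shifted density. *)
Lemma expR_normal_pdf (R : realType) (m s l x : R) : s != 0 ->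
  expR (l * x) * normal_pdf m s x =
  expR (l * m + l ^+ 2 * s ^+ 2 / 2) * normal_pdf (m + l * s ^+ 2) s x.
Proof.
move=> s0; rewrite !normal_pdfE// /normal_fun mulrCA [RHS]mulrCA; congr (_ * _).
rewrite -!expRD; congr expR; rewrite -mulr_natr.
by field.
Qed.

Lemma normal_peak_scaling (F : fieldType) (s c q : F) :
  (s / c) ^+ 2 * q *+ 2 = c^-1 ^+ 2 * (s ^+ 2 * q *+ 2).
Proof. by rewrite exprMn mulrnAr (mulrC (s ^+ 2)); congr (_ *+ 2); rewrite -mulrA. Qed.

(** A centred Gaussian factor only changes the deviation. This gives E exp(-a X^2) in closed form,
    from which the variance parameter is extracted without integrating [x ^+ 2] against the
    density. *)
Lemma normal_pdf_shrink (R : realType) (s c x : R) : 0 < s -> 0 < c ->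
  expR (- (c ^+ 2 - 1) / (2 * s ^+ 2) * x ^+ 2) * normal_pdf 0 s x =
  c^-1 * normal_pdf 0 (s / c) x.
Proof.
move=> s0 c0; have sn : s != 0 by rewrite gt_eqF.
have cn : c != 0 by rewrite gt_eqF.
rewrite !normal_pdfE ?mulf_neq0 ?invr_eq0// /normal_fun mulrCA mulrA.
have -> : normal_peak (s / c) = c * normal_peak s.
  rewrite /normal_peak.
  have -> : (s / c) ^+ 2 * pi *+ 2 = c^-1 ^+ 2 * (s ^+ 2 * pi *+ 2).
    exact: normal_peak_scaling.
  rewrite sqrtrM ?sqr_ge0// sqrtr_sqr ger0_norm ?invr_ge0 ?ltW//.
  by rewrite invfM invrK.
rewrite -!mulrA mulKf//; congr (_ * _).
rewrite -expRD; congr expR.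
rewrite -(mulr_natr (s ^+ 2)) -(mulr_natr ((s / c) ^+ 2)) !subr0.
by field; rewrite sn cn.
Qed.

Section GaussianMoments.
Context {R : realType} {disp : measure_display} {Omega : measurableType disp}
  (P : probability Omega R).

Lemma gaussian_integral (X : {RV P >-> R}) (m s : R) (f : _ -> \bar R) :
  (forall A : set R, measurable A ->
     pushforward P X A = if s == 0 then \d_m A else normal_prob m s A) ->
  measurable_fun setT f -> (forall x, 0 <= f x)%E ->
  (\int[P]_w f (X w) = if (s == 0)%R then f m
   else \int[lebesgue_measure]_x (f x * (normal_pdf m s x)%:E))%E.
Proof.
move=> law mf f0.
have mX : measurable_fun setT (X : Omega -> measurableTypeR R).
  exact: (measurable_funPT X).
have := @ge0_integral_pushforward _ _ _ (measurableTypeR R) _ _ mX P setT f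
  measurableT mf (fun x _ => f0 x).
rewrite preimage_setT => <-.
case: ifPn law => s0 law; last first.
  rewrite -ge0_integral_normal_prob//.
  by apply: eq_measure_integral => A mA _; exact: law.
rewrite (@eq_measure_integral _ (measurableTypeR R) _ _ (\d_(m : measurableTypeR R)))//.
  by rewrite integral_dirac// diracT mul1e.
by move=> A mA _; exact: law.
Qed.

Lemma gaussian_mgf (X : {RV P >-> R}) (m s : R) :
  (forall A : set R, measurable A ->
     pushforward P X A = if s == 0 then \d_m A else normal_prob m s A) ->
  forall l, (\int[P]_w (expR (l * X w))%:E = (expR (l * m + l ^+ 2 * s ^+ 2 / 2))%:E)%E.
Proof.
move=> law l.
have mf : measurable_fun setT (fun x : R => (expR (l * x))%:E).
  by apply/measurable_EFinP; apply: measurableT_comp => //; exact: measurable_funM.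
rewrite (gaussian_integral law mf); last by move=> x; rewrite lee_fin expR_ge0.
case: ifPn => [/eqP ->|s0]; first by rewrite expr0n mulr0 mul0r addr0.
under eq_integral do rewrite -EFinM expR_normal_pdf// EFinM.
rewrite ge0_integralZl//.
- by rewrite integral_normal_pdf mule1.
- by apply/measurable_EFinP; exact: measurable_normal_pdf.
- by move=> x _; rewrite lee_fin normal_pdf_ge0.
Qed.

Lemma integrable_expR_gaussian (X : {RV P >-> R}) : gaussian P X ->
  forall l, P.-integrable setT (fun w => (expR (l * X w))%:E).
Proof.
move=> [m [s [_ law]]] l; apply/integrableP; split.
  by apply/measurable_EFinP; apply: measurableT_comp => //; exact: measurable_funM.
under eq_integral do rewrite /= ger0_norm ?expR_ge0//.
by rewrite (gaussian_mgf law) ltry.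
Qed.

(** Dominates the square by exponentials, so that square integrability of a Gaussian variable
    follows from its moment generating function alone. *)
Lemma sqr_le_expR (x : R) : x ^+ 2 <= 4 * (expR x + expR (- x)).
Proof.
have H (y : R) : 0 <= y -> y ^+ 2 <= 4 * expR y.
  move=> y0; have -> : expR y = expR (y / 2) ^+ 2.
    by rewrite -expRM_natl; congr expR; field.
  have h := expR_ge1Dx (y / 2).
  have : (1 + y / 2) ^+ 2 <= expR (y / 2) ^+ 2 by rewrite ler_sqr ?nnegrE ?expR_ge0//; lra.
  nra.
have [x0|x0] := leP 0 x.
  by have := H _ x0; have := expR_ge0 (- x); lra.
have := H (- x); rewrite oppr_ge0 (ltW x0) => /(_ isT).
by have := expR_ge0 x; rewrite sqrrN; lra.
Qed.

Lemma Lfun2_gaussian (X : {RV P >-> R}) : gaussian P X ->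
  (X : Omega -> R) \in Lfun P 2%:E.
Proof.
move=> gX; rewrite inE; apply/andP; split; rewrite inE//=.
have sq : P.-integrable setT (fun w => (X w ^+ 2)%:E).
  apply: (@le_integrable _ _ _ _ _ _ _
    (fun w => (4 * (expR (1 * X w) + expR (- 1 * X w)))%:E)) => //.
  - by apply/measurable_EFinP; exact: measurable_funX.
  - move=> w _; rewrite lee_fin !ger0_norm ?sqr_ge0 ?mulr_ge0 ?addr_ge0 ?expR_ge0//.
    by rewrite mul1r mulN1r sqr_le_expR.
  - under eq_fun do rewrite EFinM EFinD.
    apply: integrableZl => //.
    exact: (integrableD measurableT (integrable_expR_gaussian gX 1)
      (integrable_expR_gaussian gX (- 1))).
rewrite /finite_norm unlock/= poweR_lty//.
move/integrableP : sq => [_]; congr (_ < _)%E; apply: eq_integral => w _ /=.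
by rewrite ger0_norm ?sqr_ge0// powR_mulrn// -normrX ger0_norm ?sqr_ge0.
Qed.
End GaussianMoments.

Section GaussianVariance.
Context {R : realType} {disp : measure_display} {Omega : measurableType disp}
  (P : probability Omega R).

Lemma Lfun1_gaussian (X : {RV P >-> R}) : gaussian P X ->
  (X : Omega -> R) \in Lfun P 1.
Proof. by move=> /Lfun2_gaussian; apply: Lfun_subset12; rewrite fin_num_measure. Qed.

Lemma integral_one : (\int[P]_w 1%:E = 1%:E)%E.
Proof. by have := @expectation_cst _ _ _ P 1; rewrite unlock. Qed.

(** Integrating exp(lX) >= 1 + lX leaves [0 <= l * m + l^2 s^2 / 2] for every [l]; a small [l] of
    sign opposite to [m] violates this unless [m = 0]. *)
Lemma centered_gaussian_mean (X : {RV P >-> R}) (m s : R) :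
  (forall A : set R, measurable A ->
     pushforward P X A = if s == 0 then \d_m A else normal_prob m s A) ->
  gaussian P X -> ('E_P[X] = 0)%E -> m = 0.
Proof.
move=> law gX EX0.
have i1 : P.-integrable setT (fun=> 1%:E) by apply/Lfun1_integrable; exact: Lfun_cst.
have i2 : P.-integrable setT (EFin \o X) by apply/Lfun1_integrable/Lfun1_gaussian.
have key l : 0 <= l * m + l ^+ 2 * s ^+ 2 / 2.
  rewrite -ler_expR expR0 -lee_fin -(gaussian_mgf law).
  have -> : (1 = \int[P]_w (1 + l * X w)%:E :> \bar R)%E.
    under eq_integral do rewrite EFinD EFinM.
    rewrite (integralD measurableT i1 (integrableZl measurableT _ i2)).
    rewrite integral_one integralZl//.
    by rewrite unlock in EX0; rewrite EX0 mule0 adde0.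
  apply: le_integral => //.
  - under eq_fun do rewrite EFinD EFinM.
    exact: (integrableD measurableT i1 (integrableZl measurableT _ i2)).
  - exact: integrable_expR_gaussian.
  - by move=> w _; rewrite lee_fin expR_ge1Dx.
(* The minimiser is [- m / s^2]; the added 1 in the denominator also covers the degenerate case
   [s = 0]. *)
have := key (- m / (s ^+ 2 + 1)).
have s1 : 0 < s ^+ 2 + 1 by rewrite ltr_wpDl// sqr_ge0.
have -> : - m / (s ^+ 2 + 1) * m + (- m / (s ^+ 2 + 1)) ^+ 2 * s ^+ 2 / 2 =
   - (m ^+ 2) * ((s ^+ 2 + 2) / (2 * (s ^+ 2 + 1) ^+ 2)) by field; rewrite gt_eqF.
rewrite mulNr oppr_ge0 pmulr_lle0 ?divr_gt0//; last 2 first.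
- by rewrite ltr_wpDl ?sqr_ge0.
- by rewrite mulr_gt0// exprn_gt0.
by move=> h; apply/eqP; rewrite -sqrf_eq0 eq_le h sqr_ge0.
Qed.

(* Integrating [exp (-(c^2-1) X^2 / (2 s^2)) >= 1 - (c^2-1) X^2 / (2 s^2)],
   whose left-hand side has mean [1/c], and letting [c] tend to 1. *)
Lemma centered_gaussian_variance (X : {RV P >-> R}) (s : R) : 0 <= s ->
  (forall A : set R, measurable A ->
     pushforward P X A = if s == 0 then \d_(0 : R) A else normal_prob 0 s A) ->
  gaussian P X -> s ^+ 2 <= fine 'E_P[fun w => X w ^+ 2].
Proof.
move=> s0 law gX; have i1 : P.-integrable setT (fun=> 1%:E) by apply/Lfun1_integrable; exact: Lfun_cst.
have i2 := Lfun2_integrable_sqr (Lfun2_gaussian gX).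
set v := fine _.
have v0 : 0 <= v by apply: fine_ge0; apply: expectation_ge0 => w; exact: sqr_ge0.
have Ev : (\int[P]_w (X w ^+ 2)%:E = v%:E)%E.
  by rewrite /v unlock fineK//; exact: integrable_fin_num.
have [->|sn] := eqVneq s 0; first by rewrite expr0n.
have sp : 0 < s by rewrite lt_neqAle eq_sym sn.
suff key c : 1 < c -> 2 * s ^+ 2 <= v * (c * (c + 1)).
  apply/ler_addgt0Pr => e e0.
  (* For [c = 1 + d] with [d <= 1] one has [c (c + 1) <= 2 + 4 d], and this [d] makes
     [4 v d <= 2 e]. *)
  pose d := Num.min 1 (e / (2 * (v + 1))).
  have v1 : 0 < 2 * (v + 1) by lra.
  have d0 : 0 < d by rewrite lt_min ltr01 divr_gt0.
  have d1 : d <= 1 by rewrite ge_min lexx.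
  have dv : 2 * (v + 1) * d <= e by rewrite mulrC -ler_pdivlMr// ge_min lexx orbT.
  have /key : 1 < 1 + d by lra.
  by have : d * d <= d; nra.
move=> c1; have c0 : 0 < c by lra.
set a := (c ^+ 2 - 1) / (2 * s ^+ 2).
have a0 : 0 <= a by rewrite divr_ge0 ?mulr_ge0 ?sqr_ge0// subr_ge0 -[1](expr1n _ 2) ler_sqr ?nnegrE; lra.
have mf : measurable_fun setT (fun x : R => (expR (- a * x ^+ 2))%:E).
  by apply/measurable_EFinP; apply: measurableT_comp => //; apply: measurable_funM => //; exact: measurable_funX.
have Ea : (\int[P]_w (expR (- a * X w ^+ 2))%:E = c^-1%:E)%E.
  rewrite (gaussian_integral law mf); last by move=> x; rewrite lee_fin expR_ge0.
  rewrite (negbTE sn) /a.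
  under eq_integral do rewrite -EFinM -mulNr normal_pdf_shrink// EFinM.
  rewrite ge0_integralZl//.
  - by rewrite integral_normal_pdf mule1.
  - by apply/measurable_EFinP; exact: measurable_normal_pdf.
  - by move=> x _; rewrite lee_fin normal_pdf_ge0.
  by rewrite lee_fin invr_ge0 ltW.
have Eb : (\int[P]_w (1 - a * X w ^+ 2)%:E = (1 - a * v)%:E)%E.
  under eq_integral do rewrite -mulNr EFinD EFinM.
  rewrite (integralD measurableT i1 (integrableZl measurableT _ i2)).
  rewrite integral_one integralZl//.
  by rewrite [X in (_ * X)%E]Ev -EFinM -EFinD mulNr.
have : 1 - a * v <= c^-1.
  rewrite -lee_fin -Ea -Eb; apply: le_integral => //.
  - under eq_fun do rewrite -mulNr EFinD EFinM.
    exact: (integrableD measurableT i1 (integrableZl measurableT _ i2)).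
  - apply/integrableP; split.
      apply/measurable_EFinP; apply: measurableT_comp => //; apply: measurable_funM => //.
      exact: measurable_funX.
    under eq_integral do rewrite /= ger0_norm ?expR_ge0//.
    by rewrite Ea ltry.
  - by move=> w _; rewrite lee_fin -mulNr expR_ge1Dx.
rewrite -subr_ge0.
have -> : c^-1 - (1 - a * v) =
  (v * (c * (c + 1)) - 2 * s ^+ 2) * ((c - 1) / (2 * s ^+ 2 * c)).
  by rewrite /a; field; rewrite sn gt_eqF.
by rewrite pmulr_lge0 ?subr_ge0// divr_gt0 ?mulr_gt0 ?exprn_gt0//; lra.
Qed.

Lemma centered_gaussian_mgf (X : {RV P >-> R}) : gaussian P X -> ('E_P[X] = 0)%E ->
  (\int[P]_w (expR (X w))%:E <= (expR (fine 'E_P[fun w => X w ^+ 2] / 2))%:E)%E.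
Proof.
move=> gX EX0; have [m [s [s0 law]]] := gX.
have m0 := centered_gaussian_mean law gX EX0.
rewrite {}m0 in law.
have := gaussian_mgf law 1; under eq_integral do rewrite mul1r.
move=> ->; rewrite lee_fin ler_expR mulr0 add0r expr1n mul1r.
by rewrite ler_pM2r ?invr_gt0//; exact: centered_gaussian_variance.
Qed.

(** The integral of a nonnegative function is a supremum over the simple functions below it, hence
    monotone for arbitrary functions. In this form it applies to the injective norm of the sample,
    an uncountable supremum. *)
Lemma ge0_le_integral_dom (f g : Omega -> \bar R) : (forall w, 0 <= f w)%E ->
  (forall w, f w <= g w)%E -> (\int[P]_w f w <= \int[P]_w g w)%E.
Proof.
move=> f0 fg; have g0 w : (0 <= g w)%E := le_trans (f0 w) (fg w).
rewrite !ge0_integralTE//; apply: le_ereal_sup => _ [h hf <-].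
by exists h => // w; exact: le_trans (hf w) (fg w).
Qed.
End GaussianVariance.

(** * Product measures and tilted noise *)

Section ProductMoments.
Context {R : comPzRingType} {J B : finType}.
Variables (h a : J -> B -> R).
Hypothesis h1 : forall j, \sum_b h j b = 1.
Hypothesis ha : forall j, \sum_b h j b * a j b = 0.

Lemma sum_prod_weights : \sum_(w : {ffun J -> B}) \prod_j h j (w j) = 1.
Proof. by rewrite -(bigA_distr_bigA h) big1. Qed.

Lemma sum_prod_moment1 i :
  \sum_(w : {ffun J -> B}) (\prod_j h j (w j)) * a i (w i) = 0.
Proof.
pose A j b := if j == i then a i b else 1.
under eq_bigr => w _.
  have -> : a i (w i) = \prod_j A j (w j).
    by rewrite (bigD1 i)//= /A eqxx big1 ?mulr1// => j /negbTE ->.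
  rewrite -big_split /=; over.
rewrite -(bigA_distr_bigA (fun j b => h j b * A j b)) (bigD1 i)//= /A eqxx.
by rewrite ha mul0r.
Qed.

Lemma sum_prod_moment2 i i' :
  \sum_(w : {ffun J -> B}) (\prod_j h j (w j)) * (a i (w i) * a i' (w i')) =
  if i == i' then \sum_b h i b * a i b ^+ 2 else 0.
Proof.
(* A factor living on one coordinate is written as a product over all coordinates, so that the sum
   over functions factors by distributivity. *)
pose A i j b := if j == i then a i b else 1.
have AE k (w : {ffun J -> B}) : a k (w k) = \prod_j A k j (w j).
  by rewrite (bigD1 k)//= /A eqxx big1 ?mulr1// => j /negbTE ->.
under eq_bigr => w _ do rewrite (AE i) (AE i') -!big_split /=.
rewrite -(bigA_distr_bigA (fun j b => h j b * (A i j b * A i' j b))).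
rewrite (bigD1 i)//= {1}/A eqxx.
case: eqVneq => [<-|ii'] /=.
  rewrite [X in _ * X]big1 ?mulr1.
    by apply: eq_bigr => b _; rewrite /A eqxx expr2.
  by move=> j /negbTE ji; under eq_bigr do rewrite /A ji !mulr1; exact: h1.
suff -> : \sum_b h i b * (a i b * A i' i b) = 0 by rewrite mul0r.
under eq_bigr do rewrite /A (negbTE ii') mulr1.
exact: ha.
Qed.
End ProductMoments.

(* [g x] is the law of [Y] tilted to have mean [x]: a normalised sum of [M]
   signs whose bias is [x / (t sqrt M)]; [u] is the uniform weight. *)
Lemma tilted_noise (R : realType) (t : R) : 0 < t ->
  exists (W : finType) (u : R) (Y : W -> R) (g : R -> W -> R),
  [/\ 0 < u, \sum_(w : W) u = 1 &
   forall x, `|x| <= 1 ->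
   [/\ forall w, 0 <= g x w, \sum_w g x w = 1,
       \sum_w g x w * (Y w - x) = 0,
       \sum_w g x w * (Y w - x) ^+ 2 <= t ^+ 2 &
       \sum_w g x w ^+ 2 / u <= expR (x ^+ 2 / t ^+ 2)]].
Proof.
move=> t0.
(* Enough signs for the bias [x / (t sqrt M)] to lie in [-1, 1] whenever [|x| <= 1], so that the
   tilted weights are nonnegative. *)
have [M M0 Mt] : exists2 M : nat, (0 < M)%N & 1 <= t ^+ 2 * M%:R.
  exists (Num.truncn (t ^- 2)).+1 => //.
  rewrite mulrC -ler_pdivrMr ?exprn_gt0// div1r.
  exact/ltW/truncnS_gt.
have Mr : (0 : R) < M%:R by rewrite ltr0n.
pose q : R := Num.sqrt M%:R.
have q0 : 0 < q by rewrite sqrtr_gt0.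
have qq : q ^+ 2 = M%:R by rewrite sqr_sqrtr ?ltW.
have tq : 1 <= t * q.
  have h : 1 <= (t * q) ^+ 2 by rewrite exprMn qq.
  by have h0 : 0 < t * q; [exact: mulr_gt0 | nra].
pose sg (b : bool) : R := (-1) ^+ b.
pose th x := x / (t * q).
pose h x (b : bool) := (1 + th x * sg b) / 2.
pose a x b := sg b - th x.
have sumb (F : bool -> R) : \sum_b F b = F true + F false.
  by rewrite (bigD1 true)//= (bigD1 false)//= big_pred0 ?addr0//; case.
have h1 x : \sum_b h x b = 1 by rewrite sumb /h /sg /= expr0 expr1; field.
have ha x : \sum_b h x b * a x b = 0.
  by rewrite sumb /h /a /sg /= expr0 expr1; field.
(* With the factor [t / q] the mean is [(t / q) * M * th x = x] and the variance is
   [t^2 (1 - th x^2)]. *)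
pose Y (w : {ffun 'I_M -> bool}) := t / q * \sum_j sg (w j).
pose g x (w : {ffun 'I_M -> bool}) := \prod_j h x (w j).
have Yx x w : Y w - x = t / q * \sum_j a x (w j).
  rewrite /Y /a sumrB sumr_const card_ord mulrBr; congr (_ - _).
  by rewrite -[_ *+ M]mulr_natr -qq /th; field; rewrite !gt_eqF.
exists {ffun 'I_M -> bool}, (2^-1 ^+ M), Y, g; split.
- by rewrite exprn_gt0// invr_gt0.
- rewrite sumr_const card_ffun card_ord card_bool -[_ *+ (2 ^ M)]mulr_natr natrX -exprMn.
  by rewrite mulVf ?expr1n// pnatr_eq0.
move=> x x1; split.
- move=> w; apply: prodr_ge0 => j _; rewrite divr_ge0//.
  have : `|th x * sg (w j)| <= 1.
    rewrite normrM normrX normrN1 expr1n mulr1 normrM normfV.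
    rewrite ler_pdivrMr ?normr_gt0 ?mulf_neq0 ?gt_eqF// mul1r.
    by apply: le_trans x1 _; rewrite normrM (ger0_norm (ltW t0)) (ger0_norm (ltW q0)).
  by rewrite ler_norml => /andP[+ _]; lra.
- exact: (@sum_prod_weights _ 'I_M bool (fun=> h x) (fun=> h1 x)).
- under eq_bigr do rewrite Yx mulrCA mulr_sumr.
  rewrite -mulr_sumr exchange_big /= big1 ?mulr0// => j _.
  exact: (@sum_prod_moment1 _ 'I_M bool (fun=> h x) (fun=> a x) (fun=> ha x) j).
- have Y2 w : (Y w - x) ^+ 2 =
      (t / q) ^+ 2 * \sum_j \sum_k a x (w j) * a x (w k).
    rewrite Yx exprMn; congr (_ * _); rewrite expr2 mulr_suml.
    by apply: eq_bigr => j _; rewrite mulr_sumr.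
  have M2 i k : \sum_w g x w * (a x (w i) * a x (w k)) =
      if i == k then \sum_b h x b * a x b ^+ 2 else 0.
    exact: (@sum_prod_moment2 _ 'I_M bool (fun=> h x) (fun=> a x) (fun=> h1 x) (fun=> ha x)).
  under eq_bigr do rewrite Y2 mulrCA mulr_sumr.
  rewrite -mulr_sumr exchange_big /=.
  rewrite [X in _ * X](_ : _ = \sum_(j < M) (1 - th x ^+ 2)); last first.
    apply: eq_bigr => j _.
    under eq_bigr do rewrite mulr_sumr.
    rewrite exchange_big /= (bigD1 j)//=.
    rewrite M2 eqxx [X in _ + X]big1; last first.
      move=> k kj; rewrite M2.
      by rewrite eq_sym (negbTE kj).
    by rewrite addr0 sumb /h /a /sg /= expr0 expr1; field.
  rewrite sumr_const card_ord -[_ *+ M]mulr_natr -qq exprMn exprVn mulrA mulrAC.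
  rewrite divfK ?expf_neq0 ?gt_eqF//.
  by rewrite ler_piMr ?sqr_ge0// gerBl sqr_ge0.
- have -> : \sum_w g x w ^+ 2 / 2^-1 ^+ M =
      \sum_(w : {ffun 'I_M -> bool}) \prod_j (h x (w j) ^+ 2 * 2).
    apply: eq_bigr => w _.
    by rewrite big_split /= prodr_const card_ord prodrXl exprVn invrK.
  rewrite -(bigA_distr_bigA (fun _ b => h x b ^+ 2 * 2)) prodr_const card_ord.
  (* The squared density of one biased sign has mean [1 + th^2] under the unbiased law. For [M]
     signs this gives [(1 + th^2)^M <= exp (M th^2)], and [M th^2 = x^2 / t^2] whatever [M] is. *)
  have -> : \sum_b h x b ^+ 2 * 2 = 1 + th x ^+ 2.
    by rewrite sumb /h /sg /= expr0 expr1; field.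
  have -> : x ^+ 2 / t ^+ 2 = M%:R * th x ^+ 2.
    by rewrite -qq /th; field; rewrite !gt_eqF.
  rewrite expRM_natl; apply: lerXn2r; rewrite ?nnegrE ?expR_ge0 ?expR_ge1Dx//.
  by rewrite addr_ge0 ?sqr_ge0.
Qed.

(** * Quadratic forms of product tensors *)

Section QuadraticForm.
Context {R : realType} {d r : nat}.
Implicit Types (G : r.-tuple 'I_d -> r.-tuple 'I_d -> R) (c : tensor R d r).

Definition tprod (x : 'I_r -> 'I_d -> R) : tensor R d r :=
  fun i => \prod_(k < r) x k (tnth i k).

Definition qform G c : R := \sum_i \sum_j c i * c j * G i j.

(** Independence of the slots: the expected form depends on each random slot only through its matrix
    of second moments. Two random product tensors with the same slot matrices can therefore be
    exchanged, which is how noise is traded for basis vectors below. *)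
Lemma expected_qform (E : finType) (p : 'I_r -> E -> R)
    (z : 'I_r -> E -> 'I_d -> R) G :
  \sum_(w : {ffun 'I_r -> E}) (\prod_k p k (w k)) *
    qform G (tprod (fun k => z k (w k))) =
  \sum_i \sum_j
    (\prod_k \sum_e p k e * (z k e (tnth i k) * z k e (tnth j k))) * G i j.
Proof.
rewrite /qform; under eq_bigr do rewrite mulr_sumr.
rewrite exchange_big; apply: eq_bigr => i _ /=.
under eq_bigr do rewrite mulr_sumr.
rewrite exchange_big; apply: eq_bigr => j _ /=.
rewrite (bigA_distr_bigA
  (fun k e => p k e * (z k e (tnth i k) * z k e (tnth j k)))) mulr_suml.
by apply: eq_bigr => w _; rewrite mulrA !big_split.
Qed.

Lemma qform_scale G (a : R) c : qform G (fun i => a * c i) = a ^+ 2 * qform G c.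
Proof.
rewrite /qform mulr_sumr; apply: eq_bigr => i _.
by rewrite mulr_sumr; apply: eq_bigr => j _; ring.
Qed.

Variable G : r.-tuple 'I_d -> r.-tuple 'I_d -> R.
Hypothesis Gsym : forall i j, G i j = G j i.
Hypothesis Gpsd : forall c, 0 <= qform G c.

Let bil (a b : tensor R d r) : R := \sum_i \sum_j a i * b j * G i j.

Let bil_le a b : bil a b <= (qform G a + qform G b) / 2.
Proof.
have bsym : bil a b = bil b a.
  rewrite /bil exchange_big; apply: eq_bigr => i _; apply: eq_bigr => j _ /=.
  by rewrite Gsym (mulrC (a j)).
suff : qform G (fun i => a i - b i) = qform G a - bil a b - bil b a + qform G b.
  by have := Gpsd (fun i => a i - b i); rewrite bsym; lra.
rewrite /qform /bil -!sumrB -big_split; apply: eq_bigr => i _ /=.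
rewrite -!sumrB -big_split; apply: eq_bigr => j _ /=.
by ring.
Qed.

Lemma qform_sum_le (S : finType) (A : {pred S}) (c : S -> tensor R d r) :
  qform G (fun i => \sum_(s in A) c s i) <= #|A|%:R * \sum_(s in A) qform G (c s).
Proof.
have -> : qform G (fun i => \sum_(s in A) c s i) =
    \sum_(s in A) \sum_(s' in A) bil (c s) (c s').
  rewrite /qform /bil.
  under eq_bigr do under eq_bigr do rewrite mulr_suml mulr_suml.
  under eq_bigr do rewrite exchange_big.
  rewrite exchange_big; apply: eq_bigr => s _ /=.
  under eq_bigr do under eq_bigr do rewrite mulr_sumr mulr_suml.
  under eq_bigr do rewrite exchange_big.
  by rewrite exchange_big.
apply: (@le_trans _ _ (\sum_(s in A) \sum_(s' in A)
    (qform G (c s) / 2 + qform G (c s') / 2))).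
  apply: ler_sum => s _; apply: ler_sum => s' _.
  by rewrite -mulrDl bil_le.
under eq_bigr do rewrite big_split /= sumr_const -mulr_suml.
rewrite big_split /= sumr_const sumrMnl -mulr_suml.
by rewrite -mulrnDl -splitr mulr_natl.
Qed.

Lemma qform_wsum_le (S : finType) (w : S -> R) (c : S -> tensor R d r) :
  qform G (fun i => \sum_s w s * c s i) <=
  (\sum_s w s ^+ 2) * \sum_s qform G (c s).
Proof.
have bilZ (u v : R) a b : bil (fun i => u * a i) (fun i => v * b i) = u * v * bil a b.
  rewrite /bil mulr_sumr; apply: eq_bigr => i _.
  by rewrite mulr_sumr; apply: eq_bigr => j _; ring.
(* The two weights are swapped before AM-GM is applied: it then produces
   [w s' ^+ 2 * qform G (c s)], whose double sum factors into the Cauchy-Schwarz bound. *)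
have -> : qform G (fun i => \sum_s w s * c s i) =
    \sum_s \sum_s' bil (fun i => w s' * c s i) (fun i => w s * c s' i).
  transitivity (\sum_s \sum_s' w s * w s' * bil (c s) (c s')); last first.
    by apply: eq_bigr => s _; apply: eq_bigr => s' _; rewrite bilZ (mulrC (w s)).
  rewrite /qform /bil.
  under eq_bigr do under eq_bigr do rewrite mulr_suml mulr_suml.
  under eq_bigr do rewrite exchange_big.
  rewrite exchange_big; apply: eq_bigr => s _ /=.
  under eq_bigr do under eq_bigr do rewrite mulr_sumr mulr_suml.
  under eq_bigr do rewrite exchange_big.
  rewrite exchange_big; apply: eq_bigr => s' _ /=.
  rewrite mulr_sumr; apply: eq_bigr => i _.
  by rewrite mulr_sumr; apply: eq_bigr => j _; ring.
apply: (@le_trans _ _ (\sum_s \sum_s'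
    (w s' ^+ 2 * qform G (c s) / 2 + w s ^+ 2 * qform G (c s') / 2))).
  apply: ler_sum => s _; apply: ler_sum => s' _.
  by rewrite -!qform_scale -mulrDl bil_le.
have -> : \sum_s \sum_s'
    (w s' ^+ 2 * qform G (c s) / 2 + w s ^+ 2 * qform G (c s') / 2) =
    \sum_s (\sum_s' w s' ^+ 2) * qform G (c s) / 2 +
    \sum_s w s ^+ 2 * (\sum_s' qform G (c s')) / 2.
  rewrite -big_split; apply: eq_bigr => s _.
  by rewrite big_split /= -!mulr_suml -mulr_sumr.
by rewrite -!mulr_suml -mulr_sumr -splitr.
Qed.

Lemma qformD_le a b : qform G (fun i => a i + b i) <= 2 * (qform G a + qform G b).
Proof.
suff -> : qform G (fun i => a i + b i) = qform G a + bil a b + bil b a + qform G b.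
  by have := bil_le a b; have := bil_le b a; lra.
rewrite /qform /bil -!big_split; apply: eq_bigr => i _ /=.
rewrite -!big_split; apply: eq_bigr => j _ /=.
by ring.
Qed.
End QuadraticForm.

Definition noise_weight (R : realType) (d r : nat) (W : finType) (g : R -> W -> R)
  (x : 'I_r -> 'I_d -> R) (w : {ffun 'I_r -> {ffun 'I_d -> W}}) : R :=
  \prod_k \prod_i g (x k i) (w k i).

Definition noise_point (R : realType) (d r : nat) (W : finType) (Y : W -> R)
  (w : {ffun 'I_r -> {ffun 'I_d -> W}}) : 'I_r -> 'I_d -> R :=
  fun k i => Y (w k i).

Section Noise.
Context {R : realType} {d r : nat}.
Variables (G : r.-tuple 'I_d -> r.-tuple 'I_d -> R).
Hypothesis Gsym : forall i j, G i j = G j i.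
Hypothesis Gpsd : forall c, 0 <= qform G c.

(* The slots in [S] carry all basis vectors; [l0] pins the summation index of
   every other slot, so that those contribute a single term each. *)
Definition partial_trace (l0 : 'I_d) (S : {set 'I_r}) (x : 'I_r -> 'I_d -> R) : R :=
  \sum_(l : {ffun 'I_r -> 'I_d}) qform G (tprod (fun k i =>
    if k \in S then (i == l k)%:R else (l k == l0)%:R * x k i)).

Variables (W : finType) (u t : R) (Y : W -> R) (g : R -> W -> R).
Hypothesis u0 : 0 < u.
Hypothesis u1 : \sum_(w : W) u = 1.
Hypothesis t0 : 0 < t.
Hypothesis noiseP : forall x, `|x| <= 1 ->
   [/\ forall w, 0 <= g x w, \sum_w g x w = 1,
       \sum_w g x w * (Y w - x) = 0,
       \sum_w g x w * (Y w - x) ^+ 2 <= t ^+ 2 &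
       \sum_w g x w ^+ 2 / u <= expR (x ^+ 2 / t ^+ 2)].

Definition noise_mixed (S : {set 'I_r}) (x : 'I_r -> 'I_d -> R) (k : 'I_r)
  (e : {ffun 'I_d -> W}) (i : 'I_d) : R := if k \in S then Y (e i) - x k i else x k i.

Variables (x : 'I_r -> 'I_d -> R) (l0 : 'I_d).
Hypothesis x1 : forall k i, `|x k i| <= 1.

Lemma noise_slot1 k : \sum_(e : {ffun 'I_d -> W}) \prod_i g (x k i) (e i) = 1.
Proof.
by apply: (sum_prod_weights (h := fun i => g (x k i))) => i; case: (noiseP (x1 k i)).
Qed.

Lemma noise_slot2 k i j :
  \sum_(e : {ffun 'I_d -> W}) (\prod_i g (x k i) (e i)) *
    ((Y (e i) - x k i) * (Y (e j) - x k j)) =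
  if i == j then \sum_w g (x k i) w * (Y w - x k i) ^+ 2 else 0.
Proof.
apply: (sum_prod_moment2 (h := fun i => g (x k i)) (a := fun i w => Y w - x k i)).
- by move=> l; case: (noiseP (x1 k l)).
- by move=> l; case: (noiseP (x1 k l)).
Qed.

(** Slotwise comparison of second moments. A noisy slot has a diagonal matrix with entries
    [v k l <= t^2], also produced by the basis vectors scaled by [sqrt (v k l)]; a noiseless slot
    has the rank one matrix of [x k], produced by the single index [l0]. Pulling out the scalars
    leaves the partial trace. *)
Lemma noise_mixed_le (S : {set 'I_r}) :
  \sum_w noise_weight g x w * qform G (tprod (fun k => noise_mixed S x k (w k))) <=
  t ^+ 2 ^+ #|S| * partial_trace l0 S x.
Proof.
pose v k l := \sum_w g (x k l) w * (Y w - x k l) ^+ 2.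
have v0 k l : 0 <= v k l.
  by apply: sumr_ge0 => w _; rewrite mulr_ge0 ?sqr_ge0//; case: (noiseP (x1 k l)).
pose e (l : 'I_r -> 'I_d) k i : R :=
  if k \in S then (i == l k)%:R else (l k == l0)%:R * x k i.
pose b k l i : R :=
  if k \in S then Num.sqrt (v k l) * (i == l)%:R else (l == l0)%:R * x k i.
have -> : \sum_w noise_weight g x w * qform G (tprod (fun k => noise_mixed S x k (w k))) =
    \sum_(l : {ffun 'I_r -> 'I_d}) (\prod_(k < r) 1) * qform G (tprod (fun k => b k (l k))).
  rewrite (expected_qform (fun k (e : {ffun 'I_d -> W}) => \prod_i g (x k i) (e i)) (noise_mixed S x)).
  rewrite (expected_qform (fun _ _ => 1) b).
  apply: eq_bigr => i _; apply: eq_bigr => j _; congr (_ * _).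
  apply: eq_bigr => k _; rewrite /noise_mixed /b.
  case kS: (k \in S); last first.
    rewrite -mulr_suml noise_slot1 mul1r (bigD1 l0)//= eqxx !mul1r big1 ?addr0// => l.
    by move=> /negbTE ->; rewrite !mul0r mulr0.
  rewrite (noise_slot2 k (tnth i k) (tnth j k)); have [->|ij] := eqVneq (tnth i k) (tnth j k).
    rewrite (bigD1 (tnth j k))//= eqxx mul1r !mulr1 -expr2 sqr_sqrtr//.
    rewrite [X in _ = _ + X]big1 ?addr0// => l.
    by rewrite eq_sym => /negbTE ->; rewrite !mulr0.
  rewrite big1// => l _; rewrite mul1r.
  have [il|] := eqVneq (tnth i k) l; last by rewrite mulr0 mul0r.
  by rewrite -il eq_sym (negbTE ij) !mulr0.
rewrite mulr_sumr; apply: ler_sum => l _; rewrite big1// mul1r.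
pose c k := if k \in S then Num.sqrt (v k (l k)) else 1.
have -> : tprod (fun k => b k (l k)) = fun i => (\prod_k c k) * tprod (e l) i.
  apply/funext => i; rewrite /tprod -big_split; apply: eq_bigr => k _ /=.
  by rewrite /b /c /e; case: ifP => // _; rewrite mul1r.
rewrite qform_scale ler_wpM2r//.
have -> : t ^+ 2 ^+ #|S| = \prod_(k < r) (if k \in S then t ^+ 2 else 1).
  by rewrite -big_mkcond prodr_const.
rewrite -prodrXl; apply: ler_prod => k _; rewrite sqr_ge0 /c; case: ifP => kS.
  by rewrite sqr_sqrtr//; case: (noiseP (x1 k (l k))).
by rewrite expr1n lexx.
Qed.

Lemma noise_point_expand w : (fun i => tprod (noise_point Y w) i - tprod x i) =
  fun i => \sum_(S in [pred S : {set 'I_r} | (0 < #|S|)%N]) tprod (fun k => noise_mixed S x k (w k)) i.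
Proof.
apply/funext => i; rewrite /tprod.
have -> : \prod_(k < r) noise_point Y w k (tnth i k) =
    \prod_(k < r) ((Y (w k (tnth i k)) - x k (tnth i k)) + x k (tnth i k)).
  by apply: eq_bigr => k _; rewrite subrK.
rewrite bigA_distr (bigD1 (finset.set0 : {set 'I_r}))//= addrAC [X in X - _ + _](_ : _ = \prod_(k < r) x k (tnth i k)).
  rewrite subrr add0r; apply: eq_big => S; first by rewrite inE card_gt0.
  by move=> _; apply: eq_bigr => k _; rewrite /noise_mixed.
by apply: eq_bigr => k _; rewrite inE.
Qed.

Lemma noise_distance_le :
  \sum_w noise_weight g x w * qform G (fun i => tprod (noise_point Y w) i - tprod x i) <=
  2 ^+ r * \sum_(S in [pred S : {set 'I_r} | (0 < #|S|)%N]) t ^+ 2 ^+ #|S| * partial_trace l0 S x.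
Proof.
have nw0 w : 0 <= noise_weight g x w.
  by apply: prodr_ge0 => k _; apply: prodr_ge0 => i _; case: (noiseP (x1 k i)).
apply: (@le_trans _ _ (\sum_w noise_weight g x w * (2 ^+ r *
   \sum_(S in [pred S : {set 'I_r} | (0 < #|S|)%N]) qform G (tprod (fun k => noise_mixed S x k (w k)))))).
  apply: ler_sum => w _; rewrite ler_wpM2l// noise_point_expand.
  apply: le_trans (qform_sum_le Gsym Gpsd _ _) _.
  rewrite ler_wpM2r ?sumr_ge0// -natrX ler_nat.
  apply: leq_trans (max_card _) _.
  by rewrite -cardsT -powersetT card_powerset cardsT card_ord.
under eq_bigr do rewrite mulrCA mulr_sumr.
rewrite -mulr_sumr exchange_big ler_wpM2l ?exprn_ge0//=.
by apply: ler_sum => S _; exact: noise_mixed_le.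
Qed.
End Noise.

(** * Packing numbers *)

(** Second moments of densities multiply over independent coordinates, so the exponents
    [x k i ^+ 2 / t ^+ 2] add up. *)
Lemma noise_weight_chi2 (R : realType) (d r : nat) (W : finType) (u t : R)
    (g : R -> W -> R) (x : 'I_r -> 'I_d -> R) : 0 < u ->
  (forall k i, \sum_w g (x k i) w ^+ 2 / u <= expR (x k i ^+ 2 / t ^+ 2)) ->
  \sum_(w : {ffun 'I_r -> {ffun 'I_d -> W}})
     noise_weight g x w ^+ 2 / \prod_(k < r) \prod_(i < d) u <=
  expR ((\sum_k \sum_i x k i ^+ 2) / t ^+ 2).
Proof.
move=> u0 gu; rewrite mulr_suml expR_sum.
have -> : \sum_(w : {ffun 'I_r -> {ffun 'I_d -> W}})
     noise_weight g x w ^+ 2 / \prod_(k < r) \prod_(i < d) u =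
   \sum_(w : {ffun 'I_r -> {ffun 'I_d -> W}})
     \prod_k \prod_i (g (x k i) (w k i) ^+ 2 / u).
  apply: eq_bigr => w _; rewrite -prodrXl -prodfV -big_split /=.
  apply: eq_bigr => k _; rewrite -prodrXl -prodfV -big_split /=.
  by [].
rewrite -(bigA_distr_bigA (fun k (e : {ffun 'I_d -> W}) =>
  \prod_i (g (x k i) (e i) ^+ 2 / u))).
apply: ler_prod => k _.
rewrite -(bigA_distr_bigA (fun i w => g (x k i) w ^+ 2 / u)).
have h i : 0 <= \sum_w g (x k i) w ^+ 2 / u <= expR (x k i ^+ 2 / t ^+ 2).
  by rewrite gu andbT sumr_ge0// => w _; rewrite divr_ge0 ?sqr_ge0 ?ltW.
rewrite prodr_ge0/=; last by move=> i _; case/andP: (h i).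
by rewrite mulr_suml expR_sum; apply: ler_prod => i _; exact: h.
Qed.

(** Here [e] is a squared distance. By Markov's inequality the noise around a point of [N] keeps
    half of its mass in the ball of squared radius [e / 4]. The chi-square bound [Q] transfers this
    to the reference law, under which each such ball has mass at least [1 / (4 Q)]; the balls are
    disjoint, so there are at most [4 Q] of them. *)
Lemma packing_bound (R : realType) (d r : nat)
    (G : r.-tuple 'I_d -> r.-tuple 'I_d -> R) (l0 : 'I_d) (t D e : R)
    (A : finType) (N : {set A}) (pt : A -> 'I_r -> 'I_d -> R) :
  (forall i j, G i j = G j i) -> (forall c, 0 <= qform G c) ->
  0 < t -> 0 < e ->
  (forall a, a \in N -> forall k i, `|pt a k i| <= 1) ->
  (forall a, a \in N -> \sum_k \sum_i pt a k i ^+ 2 <= D) ->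
  (forall a, a \in N ->
    2 ^+ r * \sum_(S in [pred S : {set 'I_r} | (0 < #|S|)%N])
       t ^+ 2 ^+ #|S| * partial_trace G l0 S (pt a) <= e / 8) ->
  (forall a b, a \in N -> b \in N -> a != b ->
    e < qform G (fun i => tprod (pt a) i - tprod (pt b) i)) ->
  #|N|%:R <= 4 * expR (D / t ^+ 2).
Proof.
move=> Gsym Gpsd t0 e0 pt1 ptD noise_e sep.
have [W [u [Y [g [u0 u1 gP]]]]] := tilted_noise t0.
pose V a w := qform G (fun i => tprod (noise_point Y w) i - tprod (pt a) i).
pose U : R := \prod_(k < r) \prod_(i < d) u.
set Q := expR (D / t ^+ 2).
have U0 : 0 < U by apply: prodr_gt0 => k _; apply: prodr_gt0.
have Q0 : 0 < Q by exact: expR_gt0.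
have U1 : \sum_(w : {ffun 'I_r -> {ffun 'I_d -> W}}) U = 1.
  rewrite -(bigA_distr_bigA (fun _ _ => \prod_(i < d) u)) big1// => k _.
  by rewrite -(bigA_distr_bigA (fun _ _ => u)) big1.
have gw0 a w : a \in N -> 0 <= noise_weight g (pt a) w.
  move=> aN; apply: prodr_ge0 => k _; apply: prodr_ge0 => i _.
  by case: (gP _ (pt1 _ aN k i)).
have gw1 a : a \in N -> \sum_w noise_weight g (pt a) w = 1.
  move=> aN; rewrite /noise_weight.
  rewrite -(bigA_distr_bigA (fun k (e : {ffun 'I_d -> W}) => \prod_i g (pt a k i) (e i))).
  rewrite big1// => k _; rewrite -(bigA_distr_bigA (fun i w => g (pt a k i) w)) big1// => i _.
  by case: (gP _ (pt1 _ aN k i)).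
have mass a : a \in N -> 1 <= 4 * Q * \sum_(w | V a w <= e / 4) U.
  move=> aN.
  have tail : \sum_(w | ~~ (V a w <= e / 4)) noise_weight g (pt a) w <= 1 / 2.
    have : e / 4 * \sum_(w | ~~ (V a w <= e / 4)) noise_weight g (pt a) w <= e / 8.
      apply: le_trans (noise_e a aN).
      apply: le_trans (noise_distance_le Gsym Gpsd gP l0 (pt1 a aN)).
      rewrite mulr_sumr big_mkcond; apply: ler_sum => w _.
      case: ifP => [|_]; last by rewrite mulr_ge0// ?gw0.
      by rewrite -ltNge [leLHS]mulrC => h; rewrite ler_wpM2l ?gw0// ltW.
    by move: (\sum_(w | _) _) => z h; rewrite -(ler_pM2l (x := e / 4)) ?divr_gt0//; lra.
  have chi : \sum_w noise_weight g (pt a) w ^+ 2 / U <= Q.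
    have h k i : \sum_w g (pt a k i) w ^+ 2 / u <= expR (pt a k i ^+ 2 / t ^+ 2).
      by case: (gP _ (pt1 _ aN k i)).
    apply: le_trans (noise_weight_chi2 u0 h) _.
    by rewrite ler_expR ler_wpM2r ?invr_ge0 ?sqr_ge0// ptD.
  have half : 1 / 2 <= \sum_(w | V a w <= e / 4) noise_weight g (pt a) w.
    by have := gw1 a aN; rewrite (bigID (fun w => V a w <= e / 4)) /=; lra.
  have : \sum_(w | V a w <= e / 4) noise_weight g (pt a) w <=
      (4 * Q)^-1 * Q + Q * \sum_(w | V a w <= e / 4) U.
    (* AM-GM: [z <= z^2 / (4 Q U) + Q U] *)
    apply: (@le_trans _ _ (\sum_(w | V a w <= e / 4)
       ((4 * Q)^-1 * (noise_weight g (pt a) w ^+ 2 / U) + Q * U))).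
      apply: ler_sum => w _; move: (noise_weight _ _ _) => z.
      rewrite -subr_ge0.
      have -> : (4 * Q)^-1 * (z ^+ 2 / U) + Q * U - z = (z - 2 * Q * U) ^+ 2 / (4 * Q * U).
        by field; rewrite !gt_eqF.
      by rewrite divr_ge0 ?sqr_ge0 ?mulr_ge0 ?ltW.
    rewrite big_split /= -!mulr_sumr lerD2r.
    apply: ler_wpM2l; first by rewrite invr_ge0 mulr_ge0// ltW.
    apply: le_trans chi; rewrite [leRHS](bigID (fun w => V a w <= e / 4)) /= lerDl.
    by apply: sumr_ge0 => w _; rewrite divr_ge0 ?sqr_ge0 ?ltW.
  rewrite invfM mulfVK ?gt_eqF//; lra.
(* A common point of two balls would put their centres within squared distance
   [2 (e / 4 + e / 4) = e] by [qformD_le], against separation. *)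
have disj : \sum_(a in N) \sum_(w | V a w <= e / 4) U <= 1.
  under eq_bigr do rewrite big_mkcond.
  rewrite exchange_big -[leRHS]U1 /=; apply: ler_sum => w _.
  rewrite -big_mkcondr /=.
  have [[a /andP[aN Va]]|none] := pselect (exists a, (a \in N) && (V a w <= e / 4)); last first.
    by rewrite big_pred0 ?ltW// => a; apply/negP => h; apply: none; exists a.
  rewrite (bigD1 a) ?aN//= big_pred0 ?addr0// => b; apply/negP => /andP[/andP[bN Vb] ba].
  have := sep b a bN aN ba; rewrite ltNge => /negP; apply.
  have -> : (fun i => tprod (pt b) i - tprod (pt a) i) =
    (fun i => (- 1) * (tprod (noise_point Y w) i - tprod (pt b) i) +
              (tprod (noise_point Y w) i - tprod (pt a) i)).
    by apply/funext => i; ring.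
  apply: le_trans (qformD_le Gsym Gpsd _ _) _.
  rewrite qform_scale sqrrN expr1n mul1r -/(V b w) -/(V a w); lra.
rewrite -sumr_const; apply: (@le_trans _ _ (\sum_(a in N) 4 * Q * \sum_(w | V a w <= e / 4) U)).
  by apply: ler_sum => a aN; exact: mass.
by rewrite -mulr_sumr ler_piMr// mulr_ge0// ltW.
Qed.

(** * Injective norms and partial traces *)

Lemma lpnorm_coord (R : realType) (d : nat) (p : R) (x : 'rV[R]_d) (i : 'I_d) :
  0 < p -> lpnorm p x <= 1 -> `|x 0 i| <= 1.
Proof.
have pw1 (a : R) : 1 `^ a = 1 by rewrite powR1.
move=> p0 xp; rewrite leNgt; apply/negP => xi.
move: xp; rewrite leNgt => /negP; apply.
rewrite /lpnorm -[X in X < _](pw1 p^-1) gt0_ltr_powR ?invr_gt0 ?nnegrE//.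
  by apply: sumr_ge0 => j _; exact: powR_ge0.
apply: (@lt_le_trans _ _ (`|x 0 i| `^ p)); last first.
  by rewrite (bigD1 i)//= lerDl sumr_ge0// => j _; exact: powR_ge0.
by rewrite -[X in X < _](pw1 p) gt0_ltr_powR ?nnegrE.
Qed.

Lemma inner_bound (R : realType) (d m : nat) (p : R) (S : tensor R d m)
    (x : 'I_m -> 'rV[R]_d) : 0 < p -> (forall k, lpnorm p (x k) <= 1) ->
  inner S (pure_tensor x) <= \sum_i `|S i|.
Proof.
move=> p0 x1; apply: ler_sum => i _; apply: le_trans (ler_norm _) _.
rewrite normrM ler_piMr// normr_prod.
apply: (@le_trans _ _ (\prod_(k < m) 1)); last by rewrite big1.
by apply: ler_prod => k _; rewrite normr_ge0 (lpnorm_coord _ p0 (x1 k)).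
Qed.

Lemma injnorm_ge (R : realType) (d m : nat) (p : R) (S : tensor R d m)
    (x : 'I_m -> 'rV[R]_d) : 0 < p -> (forall k, lpnorm p (x k) <= 1) ->
  inner S (pure_tensor x) <= injnorm p S.
Proof.
case: m S x => [|m] S x p0 x1 /=.
  rewrite /inner (bigD1 [tuple])//= big_pred0 => [|i]; last first.
    by apply/negbTE; rewrite negbK; apply/eqP; exact: tuple0.
  by rewrite addr0 /pure_tensor big_ord0 mulr1 ler_norm.
apply: ub_le_sup; last by exists x.
by exists (\sum_i `|S i|) => _ [y y1 <-]; exact: (inner_bound S p0 y1).
Qed.

Lemma injnorm_ge0 (R : realType) (d m : nat) (p : R) (S : tensor R d m) :
  0 < p -> 0 <= injnorm p S.
Proof.
case: m S => [|m] S p0; first exact: normr_ge0.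
apply: le_trans (injnorm_ge (x := fun _ => 0) S p0 _).
  rewrite /inner big1// => i _.
  by rewrite /pure_tensor big_ord_recl mxE mul0r mulr0.
move=> k; rewrite /lpnorm big1 ?powR0 ?invr_eq0 ?gt_eqF// => i _.
by rewrite mxE normr0 powR0// gt_eqF.
Qed.

Lemma injnorm_le (R : realType) (d m : nat) (p c : R) (S : tensor R d m) :
  (0 < m)%N -> 0 < p ->
  (forall x : 'I_m -> 'rV[R]_d, (forall k, lpnorm p (x k) <= 1) ->
    inner S (pure_tensor x) <= c) -> injnorm p S <= c.
Proof.
case: m S => // m S _ p0 h; apply: ge_sup => [|_ [x x1 <-]]; last exact: h.
exists (inner S (pure_tensor (fun _ => 0))); exists (fun _ => 0) => //= k.
rewrite /lpnorm big1 ?powR0 ?invr_eq0 ?gt_eqF// => i _.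
by rewrite mxE normr0 powR0// gt_eqF.
Qed.

Lemma sum_tuple_cat (V : nmodType) (d a b n : nat) (e : (a + b)%N = n)
    (F : n.-tuple 'I_d -> V) :
  \sum_i F i = \sum_(i : a.-tuple 'I_d) \sum_(j : b.-tuple 'I_d)
    F (tcast e (cat_tuple i j)).
Proof.
case: n / e F => F; rewrite pair_big /=.
rewrite (reindex (fun ij : a.-tuple 'I_d * b.-tuple 'I_d => cat_tuple ij.1 ij.2)).
  by apply: eq_bigr => ij _; rewrite ?tcast_id.
exists (fun i => (left_index i, right_index i)) => [[i j] _|i _] /=.
  congr (_, _); apply: eq_from_tnth => k; rewrite tnth_mktuple.
    exact: tnth_lshift.
  exact: tnth_rshift.
apply: eq_from_tnth => k; rewrite -[k]splitK.
case: (fintype.split k) => j /=; first by rewrite tnth_lshift tnth_mktuple.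
by rewrite tnth_rshift tnth_mktuple.
Qed.

Lemma prod_tuple_cat (R : comPzRingType) (d a b n : nat) (e : (a + b)%N = n)
    (C : 'I_n -> 'I_d -> 'I_d -> R) (i1 i2 : a.-tuple 'I_d) (j1 j2 : b.-tuple 'I_d) :
  \prod_k C k (tnth (tcast e (cat_tuple i1 j1)) k) (tnth (tcast e (cat_tuple i2 j2)) k) =
  (\prod_k C (cast_ord e (lshift b k)) (tnth i1 k) (tnth i2 k)) *
  (\prod_k C (cast_ord e (rshift a k)) (tnth j1 k) (tnth j2 k)).
Proof.
case: n / e C => C; rewrite big_split_ord ?tcast_id /=.
by congr (_ * _); apply: eq_bigr => k _;
  rewrite cast_ord_id ?tnth_lshift ?tnth_rshift.
Qed.

Lemma perm_eq_bool (s t : seq bool) :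
  size s = size t -> count id s = count id t -> perm_eq s t.
Proof.
move=> st ct; apply/seq.permP => a.
have E (v : seq bool) : count a v = (a true * count id v + a false * (size v - count id v))%N.
  rewrite -(count_predC id v) addKn; elim: v => [|c v IH] /=; first by rewrite !muln0.
  by rewrite IH; case: c => /=; lia.
by rewrite !E st ct.
Qed.

(** The last [#|S|] positions are the ones that [star] contracts in its left factor. The permutation
    is the one matching two boolean tuples with equally many entries [true]. *)
Lemma perm_to_last (r : nat) (S : {set 'I_r}) :
  exists s : 'S_r, forall k, (s k \in S) = (r - #|S| <= k)%N.
Proof.
have /tuple_permP[s hs] : perm_eq [tuple (r - #|S| <= k)%N | k < r] [tuple k \in S | k < r].
  have cnt (F : 'I_r -> bool) : count id [tuple F k | k < r] = #|[pred k | F k]|.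
    rewrite /= !count_map cardE /enum_mem size_filter.
    exact: eq_count.
  apply: perm_eq_bool; first by rewrite !size_tuple.
  rewrite !cnt; transitivity #|S|; last by apply: eq_card.
  transitivity (\sum_(r - #|S| <= k < r) 1)%N.
    move: #|S| => q; rewrite -sum1_card big_geq_mkord.
    by apply: eq_bigl => k; rewrite inE.
  rewrite sum_nat_const_nat muln1 subKn//.
  by rewrite -[X in (_ <= X)%N](card_ord r) max_card.
exists s => k; have := congr1 (fun t => tnth t k) (val_inj hs).
by rewrite !tnth_mktuple.
Qed.

Section PartialTrace.
Context {R : realType} {d r : nat}.
Variable G : r.-tuple 'I_d -> r.-tuple 'I_d -> R.
Hypothesis Gsym : forall i j, G i j = G j i.
Hypothesis Gperm : forall i i' j : r.-tuple 'I_d, perm_eq i i' -> G i j = G i' j.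

Let Gperm2 (i i' j j' : r.-tuple 'I_d) : perm_eq i i' -> perm_eq j j' -> G i j = G i' j'.
Proof. by move=> ii jj; rewrite (Gperm _ ii) Gsym (Gperm _ jj) Gsym. Qed.

Lemma qform_perm (s : 'S_r) (x : 'I_r -> 'I_d -> R) :
  qform G (tprod (fun k => x (s k))) = qform G (tprod x).
Proof.
pose f (i : r.-tuple 'I_d) := [tuple tnth i (s k) | k < r].
have f_bij : bijective f.
  exists (fun i => [tuple tnth i (s^-1 k)%g | k < r]) => i;
    by apply: eq_from_tnth => k; rewrite !tnth_mktuple ?permKV ?permK.
have fp i : perm_eq (f i) i by apply/tuple_permP; exists s.
have fx i : tprod (fun k => x (s k)) (f i) = tprod x i.
  rewrite /tprod [RHS](reindex_inj (@perm_inj _ s)) /=.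
  by apply: eq_bigr => k _; rewrite tnth_mktuple.
rewrite /qform (reindex f); last exact: onW_bij.
apply: eq_bigr => i _; rewrite (reindex f); last exact: onW_bij.
by apply: eq_bigr => j _; rewrite !fx (Gperm2 (fp i) (fp j)).
Qed.

Lemma partial_trace_perm (l0 : 'I_d) (S S' : {set 'I_r}) (s : 'S_r) (x : 'I_r -> 'I_d -> R) :
  (forall k, (s k \in S) = (k \in S')) ->
  partial_trace G l0 S x = partial_trace G l0 S' (fun k => x (s k)).
Proof.
move=> hs; rewrite /partial_trace.
pose f (l : {ffun 'I_r -> 'I_d}) := [ffun k => l ((s^-1)%g k)].
have f_bij : bijective f.
  exists (fun l : {ffun 'I_r -> 'I_d} => [ffun k => l (s k)]) => l;
    by apply/ffunP => k; rewrite !ffunE ?permKV ?permK.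
rewrite (reindex f); last exact: onW_bij.
apply: eq_bigr => l _; rewrite -(qform_perm s); congr (qform G (tprod _)).
by apply/funext => k; apply/funext => i; rewrite hs ffunE permK.
Qed.

(** Summing over basis vectors in the last [q] slots identifies the indices of the two copies there,
    which is a contraction; each of the other slots feeds its vector to both copies. *)
Lemma partial_trace_inner (l0 : 'I_d) (q : 'I_r.+1) (x : 'I_r -> 'rV[R]_d) :
  exists y : 'I_((r - q) + (r - q)) -> 'rV[R]_d,
  (forall k, exists k', y k = x k') /\
  partial_trace G l0 [set k : 'I_r | (r - q <= k)%N]%SET (fun k i => x k 0 i) =
  inner (fun i => \sum_(j : q.-tuple 'I_d)
    G (tcast (subnK (leq_ord q)) (cat_tuple (left_index i) j))
      (tcast (subnKC (leq_ord q)) (cat_tuple j (right_index i)))) (pure_tensor y).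
Proof.
set e := subnK (leq_ord q); set e' := subnKC (leq_ord q).
pose y0 (k : 'I_(r - q)) := x (cast_ord e (lshift q k)).
exists (fun k => match fintype.split k with inl k => y0 k | inr k => y0 k end); split.
  by move=> k; case: (fintype.split k) => k1; eexists.
set S := [set k | _]%SET.
have -> : partial_trace G l0 S (fun k i => x k 0 i) =
    \sum_i \sum_j (\prod_k (if k \in S then (tnth i k == tnth j k)%:R
      else x k 0 (tnth i k) * x k 0 (tnth j k))) * G i j.
  rewrite /partial_trace.
  pose B (k : 'I_r) (l i : 'I_d) : R :=
    if k \in S then (i == l)%:R else (l == l0)%:R * x k 0 i.
  (* With unit weights the sum over [l] has the shape of [expected_qform], which turns it into one
     kernel per slot: the identity on [S], rank one outside. *)
  transitivity (\sum_(l : {ffun 'I_r -> 'I_d}) (\prod_(k < r) 1) *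
      qform G (tprod (fun k => B k (l k)))).
    by apply: eq_bigr => l _; rewrite big1// mul1r.
  rewrite (expected_qform (fun _ _ => 1) B).
  apply: eq_bigr => i _; apply: eq_bigr => j _; congr (_ * _).
  apply: eq_bigr => k _; rewrite /B; case kS: (k \in S).
    rewrite (bigD1 (tnth i k))//= eqxx !mul1r big1 ?addr0 1?eq_sym// => l.
    by rewrite eq_sym => /negbTE ->; rewrite mul0r mulr0.
  rewrite (bigD1 l0)//= eqxx !mul1r big1 ?addr0// => l.
  by move=> /negbTE ->; rewrite !mul0r mulr0.
pose X (a : (r - q).-tuple 'I_d) := \prod_k y0 k 0 (tnth a k).
have -> : \sum_i \sum_j (\prod_k (if k \in S then (tnth i k == tnth j k)%:R
      else x k 0 (tnth i k) * x k 0 (tnth j k))) * G i j =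
    \sum_a \sum_a' \sum_(b : q.-tuple 'I_d) X a * X a' *
      G (tcast e (cat_tuple a b)) (tcast e (cat_tuple a' b)).
  rewrite (sum_tuple_cat e); apply: eq_bigr => a _.
  rewrite [RHS]exchange_big; apply: eq_bigr => b _.
  rewrite (sum_tuple_cat e); apply: eq_bigr => a' _ /=.
  have E b' : \prod_k (if k \in S then
        (tnth (tcast e (cat_tuple a b)) k == tnth (tcast e (cat_tuple a' b')) k)%:R
      else x k 0 (tnth (tcast e (cat_tuple a b)) k) * x k 0 (tnth (tcast e (cat_tuple a' b')) k)) =
      X a * X a' * (b == b')%:R.
    rewrite (prod_tuple_cat e (fun k i j => if k \in S then (i == j)%:R else x k 0 i * x k 0 j)).
    rewrite /X -big_split; congr (_ * _).
      by apply: eq_bigr => k _; rewrite inE /= leqNgt ltn_ord.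
    have [<-|bb'] := eqVneq b b'.
      by rewrite big1// => k _; rewrite inE /= leq_addr eqxx.
    have [k hk] : exists k, tnth b k != tnth b' k.
      apply/existsP; apply: contraNT bb'; rewrite negb_exists => /forallP h.
      by apply/eqP/eq_from_tnth => k; apply/eqP; rewrite -[_ == _]negbK.
    by rewrite (bigD1 k)//= inE /= leq_addr (negbTE hk) mul0r.
  rewrite (bigD1 b)//= E eqxx mulr1 big1 ?addr0// => b'.
  by rewrite E eq_sym => /negbTE ->; rewrite mulr0 mul0r.
rewrite /inner (sum_tuple_cat (erefl ((r - q) + (r - q))%N)).
apply: eq_bigr => a _; apply: eq_bigr => a' _; rewrite ?tcast_id [RHS]mulrC mulr_sumr.
have -> : left_index (cat_tuple a a') = a.
  by apply: eq_from_tnth => k; rewrite tnth_mktuple tnth_lshift.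
have -> : right_index (cat_tuple a a') = a'.
  by apply: eq_from_tnth => k; rewrite tnth_mktuple tnth_rshift.
apply: eq_bigr => b _; congr (_ * _).
  rewrite /pure_tensor big_split_ord /=; congr (_ * _); apply: eq_bigr => k _.
    by rewrite (unsplitK (inl k)) tnth_lshift.
  by rewrite (unsplitK (inr k)) tnth_rshift.
(* In its right factor [star] puts the contracted indices first, so the two blocks are exchanged by
   symmetry. *)
apply: Gperm2 => //; rewrite !val_tcast /= perm_catC.
exact: perm_refl.
Qed.
End PartialTrace.

(** * Chaining *)

Lemma innerDr_scale (R : realType) (d r : nat) (t x y : tensor R d r) (c : R) :
  inner t (fun i => c * (x i - y i)) = c * (inner t x - inner t y).
Proof.
rewrite /inner -sumrB mulr_sumr; apply: eq_bigr => i _; ring.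
Qed.

(* By [1 + y <= expR y] each link is majorised, for every tensor [t], by a constant plus
   exponentials of linear forms in [t]; no expectation of a maximum is needed. *)
Lemma chaining (R : realType) (d r : nat) (G : r.-tuple 'I_d -> r.-tuple 'I_d -> R)
    (A : finType) (pt : A -> tensor R d r) (N : nat -> {set A})
    (phi : nat -> A -> A) (v l : nat -> R) (a0 : A) (K : nat) :
  N 0%N = [set a0]%SET -> (forall i, pt a0 i = 0) ->
  (forall k, (k < K)%N -> [/\ 0 < v k, 1 <= l k &
     #|N k.+1|%:R <= expR (l k ^+ 2)]) ->
  (forall k n, (k < K)%N -> n \in N k.+1 -> phi k n \in N k /\
     qform G (fun i => pt n i - pt (phi k n) i) <= v k ^+ 2) ->
  exists (I : finType) (b : R) (a : I -> R) (C : I -> tensor R d r),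
  [/\ 0 <= b, forall i, 0 <= a i,
      forall t n, n \in N K ->
        inner t (pt n) <= b + \sum_i a i * expR (inner t (C i)) &
      b + \sum_i a i * expR (qform G (C i) / 2) <= \sum_(k < K) 3 / 2 * v k * l k].
Proof.
move=> N0 pt0; elim: K => [|K IH] hv hphi.
  exists void, 0, (fun=> 0), (fun=> pt a0); split => //.
    move=> t n; rewrite N0 inE => /eqP ->.
    by rewrite big1 ?addr0; [rewrite /inner big1// => i _; rewrite pt0 mulr0|case].
  by rewrite big1 ?big_ord0 ?addr0//; case.
have [I [b [a [C [b0 a0' aN aG]]]]] := IH (fun k kK => hv k (ltnW kK))
  (fun k n kK => hphi k n (ltnW kK)).
have [v0 l1 NK] := hv K (ltnSn K).
set vK := v K in v0 *; set lK := l K in l1 NK *.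
have l0 : 0 < lK := lt_le_trans ltr01 l1.
pose c n i := lK / vK * (pt n i - pt (phi K n) i).
(* The link [c n] is normalised to variance at most [lK^2]. The shift [3/2 lK^2] pays [lK^2 / 2] for
   its moment generating function and [lK^2] for the cardinality of the net; the exponentials then
   total at most [vK / lK], which the [- 1] in the constant cancels, leaving [3/2 vK lK]. *)
pose w := vK / lK * expR (- (3 / 2 * lK ^+ 2)).
have wE z : w * expR z = vK / lK * expR (- (3 / 2 * lK ^+ 2) + z).
  by rewrite /w -mulrA -expRD.
have w0 : 0 <= w by rewrite mulr_ge0 ?divr_ge0 ?expR_ge0 ?ltW.
exists (I + A)%type, (b + vK / lK * (3 / 2 * lK ^+ 2 - 1)),
  (fun i => match i with inl i => a i | inr n => if n \in N K.+1 then w else 0 end),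
  (fun i => match i with inl i => C i | inr n => c n end); split.
- rewrite addr_ge0// mulr_ge0 ?divr_ge0 ?(ltW v0) ?(ltW l0)//; nra.
- by case=> // n; case: ifP.
- move=> t n nN; rewrite big_sumType /=.
  have [pN _] := hphi K n (ltnSn K) nN.
  have step : inner t (pt n) - inner t (pt (phi K n)) <=
      vK / lK * (3 / 2 * lK ^+ 2 - 1) + w * expR (inner t (c n)).
    rewrite wE innerDr_scale -mulrDr; move: (_ - _) => y.
    have := expR_ge1Dx (- (3 / 2 * lK ^+ 2) + lK / vK * y) => h.
    have -> : y = vK / lK * (lK / vK * y) by field; rewrite !gt_eqF.
    rewrite ler_pM2l ?divr_gt0//; move: h.
    have -> : lK / vK * (vK / lK * (lK / vK * y)) = lK / vK * y by field; rewrite !gt_eqF.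
    by lra.
  have le_sum : w * expR (inner t (c n)) <=
      \sum_(n' : A) (if n' \in N K.+1 then w else 0) * expR (inner t (c n')).
    rewrite (bigD1 n)//= nN lerDl sumr_ge0// => n' _.
    by rewrite mulr_ge0 ?expR_ge0//; case: ifP.
  by have := aN t _ pN; lra.
- rewrite big_sumType /= big_ord_recr /=.
  have : \sum_(n : A) (if n \in N K.+1 then w else 0) * expR (qform G (c n) / 2) <= vK / lK.
    apply: (@le_trans _ _ (\sum_(n in N K.+1) vK / lK * expR (- lK ^+ 2))).
      rewrite [leRHS]big_mkcond; apply: ler_sum => n _; case: ifP => [nN|]; last by rewrite mul0r.
      have [_ qn] := hphi K n (ltnSn K) nN.
      rewrite wE ler_pM2l ?divr_gt0// ler_expR /c qform_scale.
      have : (lK / vK) ^+ 2 * qform G (fun i => pt n i - pt (phi K n) i) <= lK ^+ 2.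
        apply: (@le_trans _ _ ((lK / vK) ^+ 2 * vK ^+ 2)).
          by rewrite ler_wpM2l ?sqr_ge0.
        by rewrite -exprMn divfK ?gt_eqF.
      by lra.
    rewrite sumr_const -[_ *+ _]mulr_natl mulrCA ler_piMr ?divr_ge0 ?(ltW v0) ?(ltW l0)//.
    by rewrite expRN ler_pdivrMr ?expR_gt0// mul1r.
  have -> : 3 / 2 * v K * l K = vK / lK * (3 / 2 * lK ^+ 2).
    by rewrite -/vK -/lK; field; rewrite gt_eqF.
  by move: aG; set z := vK / lK; lra.
Qed.

(** * The covariance form of a Gaussian tensor *)

Section GaussianTensor.
Context {R : realType} {disp : measure_display} {Omega : measurableType disp}
  (P : probability Omega R).

Lemma expectation_lin (J : finType) (c : J -> R) (X : J -> Omega -> R) :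
  (forall j, X j \in Lfun P 1) ->
  ('E_P[fun w => (\sum_j c j * X j w)%R] = (\sum_j c j * fine 'E_P[X j])%R%:E)%E.
Proof.
move=> X1.
have cX j : (c j \o* X j)%R \in Lfun P 1 by apply: Lfun_scale.
have -> : (fun w => \sum_j c j * X j w) =
    \sum_(Y <- [seq (c j \o* X j)%R | j <- index_enum J]) Y.
  apply/funext => w; rewrite big_map fct_sumE.
  by apply: eq_bigr => j _ /=; rewrite mulrC.
rewrite expectation_sum; last by move=> Y /mapP[j _ ->].
rewrite big_map -sumEFin; apply: eq_bigr => j _.
by rewrite expectationZl// EFinM fineK// expectation_fin_num.
Qed.

Context {d r : nat} (T : r.-tuple 'I_d -> {RV P >-> R}).
Hypothesis gT : jointly_gaussian P T.

Definition covT (i j : r.-tuple 'I_d) : R := fine 'E_P[fun w => T i w * T j w].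

Let lin (c : tensor R d r) (w : Omega) : R := inner (sample T w) c.

Let linE c : lin c = fun w => \sum_i c i * T i w.
Proof. by apply/funext => w; apply: eq_bigr => i _; rewrite mulrC. Qed.

Lemma measurable_inner_sample c : measurable_fun setT (fun w => inner (sample T w) c).
Proof.
by apply: measurable_sum => i; apply: measurable_funM => //; exact: measurable_cst.
Qed.

Lemma Lfun2_T i : (T i : Omega -> R) \in Lfun P 2%:E.
Proof.
apply: Lfun2_gaussian; have := gT (fun j => (j == i)%:R).
congr (gaussian P _); apply/funext => w.
rewrite (bigD1 i)//= eqxx mul1r big1 ?addr0// => j /negbTE ->.
by rewrite mul0r.
Qed.

Lemma qform_cov c : qform covT c = fine 'E_P[fun w => inner (sample T w) c ^+ 2].
Proof.
have -> : (fun w => inner (sample T w) c ^+ 2) =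
    (fun w => \sum_(ij : r.-tuple 'I_d * r.-tuple 'I_d)
      (c ij.1 * c ij.2) * (T ij.1 w * T ij.2 w)).
  apply/funext => w; rewrite -/(lin c w) linE expr2 mulr_suml.
  under eq_bigr do rewrite mulr_sumr.
  by rewrite pair_big; apply: eq_bigr => -[i j] _ /=; ring.
rewrite (expectation_lin (fun ij => c ij.1 * c ij.2) (X := fun ij w => T ij.1 w * T ij.2 w)) /=.
  by rewrite /qform pair_big.
by move=> [i j] /=; exact: Lfun2_mul_Lfun1 (Lfun2_T i) (Lfun2_T j).
Qed.

Lemma cov_psd c : 0 <= qform covT c.
Proof.
rewrite qform_cov; apply: fine_ge0; apply: expectation_ge0 => w; exact: sqr_ge0.
Qed.

Lemma cov_sym i j : covT i j = covT j i.
Proof. by congr (fine 'E_P[_])%E; apply/funext => w; rewrite mulrC. Qed.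

Lemma cov_perm : (forall w, symmetric_tensor (sample T w)) ->
  forall i i' j : r.-tuple 'I_d, perm_eq i i' -> covT i j = covT i' j.
Proof.
move=> sT i i' j /tuple_permP[s hs]; congr (fine 'E_P[_])%E; apply/funext => w.
congr (_ * _); rewrite -[RHS](sT w s i'); congr (T _ w); exact: val_inj.
Qed.

Lemma mean_star_cov (q : 'I_r.+1) : mean_star T q = fun i => \sum_(j : q.-tuple 'I_d)
    covT (tcast (subnK (leq_ord q)) (cat_tuple (left_index i) j))
      (tcast (subnKC (leq_ord q)) (cat_tuple j (right_index i))).
Proof.
apply/funext => i; rewrite /mean_star /star.
have -> : (fun w => \sum_(j : q.-tuple 'I_d)
     sample T w (tcast (subnK (leq_ord q)) (cat_tuple (left_index i) j)) *
     sample T w (tcast (subnKC (leq_ord q)) (cat_tuple j (right_index i)))) =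
   (fun w => \sum_(j : q.-tuple 'I_d) 1 *
     (T (tcast (subnK (leq_ord q)) (cat_tuple (left_index i) j)) w *
     T (tcast (subnKC (leq_ord q)) (cat_tuple j (right_index i))) w)).
  by apply/funext => w; apply: eq_bigr => j _; rewrite mul1r.
rewrite (expectation_lin (fun=> 1) (X := fun (j : q.-tuple 'I_d) w =>
  T (tcast (subnK (leq_ord q)) (cat_tuple (left_index i) j)) w *
  T (tcast (subnKC (leq_ord q)) (cat_tuple j (right_index i))) w)) /=.
  by apply: eq_bigr => j _; rewrite mul1r.
by move=> j; exact: Lfun2_mul_Lfun1 (Lfun2_T _) (Lfun2_T _).
Qed.

Hypothesis T0 : forall i, ('E_P[T i] = 0)%E.

Lemma mgf_inner_sample c :
  (\int[P]_w (expR (inner (sample T w) c))%:E <= (expR (qform covT c / 2))%:E)%E.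
Proof.
pose X : {RV P >-> R} := HB.pack (fun w => inner (sample T w) c)
  (isMeasurableFun.Build _ _ _ _ _ (measurable_inner_sample c)).
have gX : gaussian P X.
  by have := gT c; congr (gaussian P _); exact: esym (linE c).
have X0 : ('E_P[X] = 0)%E.
  have -> : (X : Omega -> R) = fun w => \sum_i c i * T i w by exact: linE.
  rewrite (expectation_lin c (X := fun i => T i : Omega -> R)).
    by rewrite big1// => i _; rewrite T0 mulr0.
  by move=> i; apply: Lfun_subset12; [rewrite fin_num_measure | exact: Lfun2_T].
by rewrite qform_cov; exact: (centered_gaussian_mgf gX X0).
Qed.

Lemma expectation_le_exponentials (F : Omega -> R) (I : finType) (b : R) (a : I -> R)
    (C : I -> tensor R d r) : (forall w, 0 <= F w) -> 0 <= b -> (forall i, 0 <= a i) ->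
  (forall w, F w <= b + \sum_i a i * expR (inner (sample T w) (C i))) ->
  ('E_P[F] <= (b + \sum_i a i * expR (qform covT (C i) / 2))%R%:E)%E.
Proof.
move=> F0 b0 a0 Fle; rewrite unlock.
pose e i w := (a i * expR (inner (sample T w) (C i)))%:E.
have me i : measurable_fun setT (e i).
  apply/measurable_EFinP; apply: measurable_funM => //.
  by apply: measurableT_comp => //; exact: measurable_inner_sample.
have e0 i w : (0 <= e i w)%E by rewrite lee_fin mulr_ge0 ?expR_ge0.
have intE i : (\int[P]_w e i w <= (a i * expR (qform covT (C i) / 2))%:E)%E.
  rewrite /e; under eq_integral do rewrite EFinM.
  rewrite ge0_integralZl//.
  - by rewrite EFinM; apply: lee_wpmul2l; [rewrite lee_fin | exact: mgf_inner_sample].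
  - apply/measurable_EFinP.
    by apply: measurableT_comp => //; exact: measurable_inner_sample.
  - by rewrite lee_fin.
have Ssum : (\int[P]_w (\sum_i e i w) <= (\sum_i a i * expR (qform covT (C i) / 2))%R%:E)%E.
  by rewrite ge0_integral_sum// -sumEFin; apply: lee_sum.
apply: (@le_trans _ _ (\int[P]_w (b%:E + \sum_i e i w))%E).
  apply: ge0_le_integral_dom => w; first by rewrite lee_fin.
  by rewrite sumEFin -EFinD lee_fin.
rewrite ge0_integralD//; last 2 first.
- by move=> w _; rewrite sume_ge0.
- exact: emeasurable_sum.
rewrite EFinD; apply: leeD => //.
by have := @expectation_cst _ _ _ P b; rewrite unlock => ->.
Qed.
End GaussianTensor.

(** * Nets of the l_p ball *)

Lemma lpnorm_le1 (R : realType) (d : nat) (p : R) (x : 'rV[R]_d) : 0 < p ->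
  (lpnorm p x <= 1) = (\sum_i `|x 0 i| `^ p <= 1).
Proof.
move=> p0; have pw1 : 1 `^ p^-1 = 1 :> R by rewrite powR1.
have s0 : 0 <= \sum_i `|x 0 i| `^ p by apply: sumr_ge0 => i _; exact: powR_ge0.
rewrite /lpnorm; apply/idP/idP => h.
  rewrite leNgt; apply/negP => s1; move: h; rewrite leNgt => /negP; apply.
  by rewrite -[X in X < _]pw1 gt0_ltr_powR ?invr_gt0 ?nnegrE.
by rewrite -[leRHS]pw1 ge0_ler_powR ?invr_ge0 ?nnegrE// ltW.
Qed.

(** Bernoulli's inequality, from the tangent of the exponential at [th * s] with [s = ln u]:
    evaluate it at [s] and at 0 and average with weights [th] and [1 - th], so that the linear terms
    cancel. *)
Lemma powR_le_affine (R : realType) (u th : R) : 0 <= u -> 0 < th -> th <= 1 ->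
  u `^ th <= th * u + (1 - th).
Proof.
rewrite le_eqVlt => /predU1P[<-|u0] th0 th1.
  by rewrite powR0 ?gt_eqF// mulr0 add0r subr_ge0.
rewrite /powR gt_eqF//; set s := ln u.
have -> : u = expR s by rewrite lnK// posrE.
have h1 : expR s = expR (th * s) * expR ((1 - th) * s).
  by rewrite -expRD; congr expR; ring.
have h2 : 1 = expR (th * s) * expR (- (th * s)) by rewrite -expRD subrr expR0.
have e0 := expR_gt0 (th * s).
have k1 : expR (th * s) * (1 + (1 - th) * s) <= expR s.
  by rewrite h1 ler_pM2l// expR_ge1Dx.
have k2 : expR (th * s) * (1 - th * s) <= 1.
  by rewrite {2}h2 ler_pM2l// expR_ge1Dx.
move: k1 k2; set E := expR (th * s); set F := expR s => k1 k2.
have -> : E = th * (E * (1 + (1 - th) * s)) + (1 - th) * (E * (1 - th * s)) by ring.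
apply: lerD; first by rewrite ler_pM2l.
by rewrite -[leRHS]mulr1 ler_wpM2l// subr_ge0.
Qed.

(** Hölder's inequality, obtained by summing [powR_le_affine] at [u = d |x_i|^p]. The factor [d]
    makes the flat vector the point of tangency, and the affine bounds add up to at most [d]. *)
Lemma sum_sqr_lpnorm (R : realType) (d : nat) (p : R) (x : 'rV[R]_d) : (0 < d)%N ->
  2 <= p -> lpnorm p x <= 1 -> \sum_i x 0 i ^+ 2 <= d%:R `^ (1 - 2 / p).
Proof.
move=> d0 p2; have p0 : 0 < p by lra.
rewrite lpnorm_le1// => h.
have dr : (0 : R) < d%:R by rewrite ltr0n.
have th0 : 0 < 2 / p by rewrite divr_gt0.
have th1 : 2 / p <= 1 by rewrite ler_pdivrMr// mul1r.
have dE : d%:R `^ (1 - 2 / p) = d%:R / d%:R `^ (2 / p).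
  rewrite (@powRD _ d%:R 1 (- (2 / p))); last by rewrite (gt_eqF dr) implybT.
  by rewrite powRr1 ?ler0n// powRN.
rewrite dE ler_pdivlMr ?powR_gt0// mulr_suml.
apply: (@le_trans _ _ (\sum_(i < d) ((2 / p) * (d%:R * `|x 0 i| `^ p) + (1 - 2 / p)))).
  apply: ler_sum => i _.
  have u0 : 0 <= d%:R * `|x 0 i| `^ p by rewrite mulr_ge0 ?powR_ge0.
  apply: le_trans (powR_le_affine u0 th0 th1).
  rewrite powRM ?powR_ge0// -powRrM mulrC ler_pM2l ?powR_gt0//.
  by rewrite mulrCA divff ?gt_eqF// mulr1 powR_mulrn// real_normK// num_real.
rewrite big_split /= -!mulr_sumr sumr_const card_ord -[_ *+ d]mulr_natr.
move: h; set s := \sum_i _ => h.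
have : (2 / p) * (d%:R * s) <= (2 / p) * d%:R by rewrite ler_pM2l// ger_pMr.
by lra.
Qed.

Lemma lpnorm_small (R : realType) (d : nat) (p : R) (z : 'rV[R]_d) : (0 < d)%N ->
  1 <= p -> (forall i, `|z 0 i| <= d%:R^-1) -> lpnorm p z <= 1.
Proof.
move=> d0 p1 hz; have p0 : 0 < p by lra.
have dr : (0 : R) < d%:R by rewrite ltr0n.
rewrite lpnorm_le1//; apply: (@le_trans _ _ (\sum_(i < d) d%:R^-1)); last first.
  by rewrite sumr_const card_ord -[_ *+ d]mulr_natr mulVf// gt_eqF.
apply: ler_sum => i _; apply: le_trans (hz i).
have [->|z0] := eqVneq `|z 0 i| 0; first by rewrite powR0// gt_eqF.
rewrite -[leRHS]powRr1// ger_powR// lt0r z0 normr_ge0/=.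
by apply: le_trans (hz i) _; rewrite invf_le1// ler1n.
Qed.

Section Net.
Context {R : realType} (d r : nat).
Variable (p : R).
Let L := (2 * r * d)%N.

(** Multiples of [1 / L] in [-1, 1], the index [L] standing for 0. The choice [L = 2 r d] makes a
    rounding error times [2 r] at most [1 / d] in each coordinate, hence a point of the l_p ball. *)
Definition grid_vector (a : {ffun 'I_r * 'I_d -> 'I_(L.*2.+1)}) (k : 'I_r) : 'rV[R]_d :=
  \row_i (((a (k, i))%:R - L%:R) / L%:R).

Definition grid_net : {set {ffun 'I_r * 'I_d -> 'I_(L.*2.+1)}} :=
  [set a | `[< forall k, lpnorm p (grid_vector a k) <= 1 >]]%SET.

Hypotheses (d0 : (0 < d)%N) (r0 : (0 < r)%N) (p2 : 2 <= p).

Let L0 : (0 < L)%N. Proof. by rewrite !muln_gt0 r0 d0. Qed.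

Let p0 : 0 < p. Proof. by apply: lt_le_trans p2. Qed.

(** Rounding goes towards zero, so that it keeps vectors inside the l_p ball. *)
Lemma round_to_grid (y : R) : `|y| <= 1 -> exists n : 'I_(L.*2.+1),
  `|(n%:R - L%:R) / L%:R| <= `|y| /\ `|y - (n%:R - L%:R) / L%:R| <= L%:R^-1.
Proof.
move=> y1; have Lr : (0 : R) < L%:R by rewrite ltr0n.
have yL0 : 0 <= `|y| * L%:R by rewrite mulr_ge0.
set m := Num.truncn (`|y| * L%:R).
have /andP[m1 m2] : m%:R <= `|y| * L%:R < m.+1%:R by exact: truncn_itv.
have mL : (m <= L)%N.
  by rewrite -(ler_nat R); apply: le_trans m1 _; rewrite ger_pMl.
rewrite -natr1 in m2.
have k1 : m%:R / L%:R <= `|y| by rewrite ler_pdivrMr.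
have k2 : `|y| - m%:R / L%:R <= L%:R^-1.
  by rewrite lerBlDr -[X in X + _]mul1r -mulrDl ler_pdivlMr//; lra.
have q0 : 0 <= m%:R / L%:R :> R by rewrite divr_ge0.
have [y0|y0] := leP 0 y.
  have lt : (L + m < L.*2.+1)%N by rewrite ltnS -addnn leq_add2l.
  exists (Ordinal lt) => /=; rewrite natrD addrAC subrr add0r.
  rewrite (ger0_norm y0) in k1 k2 *; split; first by rewrite ger0_norm.
  by rewrite ger0_norm// subr_ge0.
have lt : (L - m < L.*2.+1)%N by rewrite ltnS -addnn (leq_trans (leq_subr _ _))// leq_addr.
exists (Ordinal lt) => /=; rewrite natrB// addrAC subrr add0r mulNr normrN opprK.
rewrite (ltr0_norm y0) in k1 k2 *; split; first by rewrite ger0_norm.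
have : 0 <= L%:R^-1 :> R by rewrite invr_ge0 ltW.
have bound (u v : R) : 0 <= v -> u <= - y -> - y - u <= v -> - v <= y + u <= v.
  by move=> *; apply/andP; split; lra.
by rewrite ler_norml => v0; exact: bound.
Qed.

Lemma grid_net_round (x : 'I_r -> 'rV[R]_d) : (forall k, lpnorm p (x k) <= 1) ->
  exists2 a, a \in grid_net & forall k i, `|x k 0 i - grid_vector a k 0 i| <= L%:R^-1.
Proof.
move=> x1.
have /choice[f hf] : forall ki : 'I_r * 'I_d, exists n : 'I_(L.*2.+1),
    `|(n%:R - L%:R) / L%:R| <= `|x ki.1 0 ki.2| /\
    `|x ki.1 0 ki.2 - (n%:R - L%:R) / L%:R| <= L%:R^-1.
  by move=> ki; apply: round_to_grid; exact: lpnorm_coord p0 (x1 _).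
exists [ffun ki => f ki].
  rewrite inE; apply/asboolP => k; rewrite lpnorm_le1//.
  apply: (@le_trans _ _ (\sum_i `|x k 0 i| `^ p)); last by rewrite -lpnorm_le1.
  apply: ler_sum => i _; rewrite mxE ffunE.
  apply: ge0_ler_powR; rewrite ?nnegrE ?normr_ge0 ?(ltW p0)//.
  by case: (hf (k, i)).
by move=> k i; rewrite mxE ffunE; case: (hf (k, i)).
Qed.

Lemma pure_hybrid_step (x y : 'I_r -> 'rV[R]_d) (m : 'I_r) (c : R) i : c != 0 ->
  pure_tensor (fun k : 'I_r => if (k < m)%N then y k else x k) i -
  pure_tensor (fun k : 'I_r => if (k < m.+1)%N then y k else x k) i =
  c^-1 * pure_tensor (fun k : 'I_r =>
    if (k < m)%N then y k else if k == m then c *: (x m - y m) else x k) i.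
Proof.
move=> c0; rewrite /pure_tensor.
have D (F : 'I_r -> R) : \prod_k F k = F m * \prod_(k | k != m) F k by rewrite (bigD1 m).
rewrite !D /= !ltnn ltnSn eqxx !mxE.
have -> : \prod_(k < r | k != m) (if (k < m.+1)%N then y k else x k) 0 (tnth i k) =
    \prod_(k < r | k != m) (if (k < m)%N then y k else x k) 0 (tnth i k).
  apply: eq_bigr => k km; rewrite ltnS leq_eqVlt.
  by have /negbTE -> : (k : nat) != m by exact: km.
have -> : \prod_(k < r | k != m) (if (k < m)%N then y k
      else if k == m then c *: (x m - y m) else x k) 0 (tnth i k) =
    \prod_(k < r | k != m) (if (k < m)%N then y k else x k) 0 (tnth i k).
  by apply: eq_bigr => k /negbTE ->.
by field.
Qed.

(** Slots are replaced by their roundings one at a time. Each error vector times [2 r] lies in the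
    ball, so a replacement costs at most [N / (2 r)]; all [r] of them cost [N / 2], which is
    absorbed on the left. *)
Lemma injnorm_le_net (t : tensor R d r) (B : R) :
  (forall a, a \in grid_net -> inner t (pure_tensor (grid_vector a)) <= B) ->
  injnorm p t <= 2 * B.
Proof.
have rr : (0 : R) < r%:R by rewrite ltr0n.
have dr : (0 : R) < d%:R by rewrite ltr0n.
move=> hB; set N := injnorm p t.
suff : N <= B + N / 2 by lra.
have key : forall x : 'I_r -> 'rV[R]_d, (forall k, lpnorm p (x k) <= 1) ->
    inner t (pure_tensor x) <= B + N / 2.
  move=> x x1; have [a aN xa] := grid_net_round x1.
  set y := grid_vector a.
  have y1 k : lpnorm p (y k) <= 1 by move: aN; rewrite inE => /asboolP; exact.
  pose h (m : nat) := pure_tensor (fun k : 'I_r => if (k < m)%N then y k else x k).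
  have step m : (m <= r)%N -> inner t (h 0%N) <= inner t (h m) + m%:R * (N / (2 * r%:R)).
    elim: m => [|m IH] mr; first by rewrite mul0r addr0.
    apply: le_trans (IH (ltnW mr)) _.
    pose c : R := 2 * r%:R.
    have c0 : 0 < c by rewrite mulr_gt0.
    pose z (k : 'I_r) := if (k < m)%N then y k
      else if k == Ordinal mr then c *: (x (Ordinal mr) - y (Ordinal mr)) else x k.
    have z1 k : lpnorm p (z k) <= 1.
      rewrite /z; case: ifP => // _; case: eqP => // _.
      apply: lpnorm_small => // [|i]; first by apply: le_trans p2; rewrite ler1n.
      rewrite !mxE normrM (gtr0_norm c0).
      apply: (@le_trans _ _ (c * L%:R^-1)).
        rewrite ler_pM2l//; have := xa (Ordinal mr) i.
        by rewrite /y /grid_vector !mxE.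
      by rewrite /c /L !natrM invfM mulrA divff ?mul1r// gt_eqF// mulr_gt0.
    have : inner t (h m) - inner t (h m.+1) = c^-1 * inner t (pure_tensor z).
      rewrite /inner -sumrB mulr_sumr; apply: eq_bigr => i _.
      rewrite -mulrBr (pure_hybrid_step x y (Ordinal mr) i (lt0r_neq0 c0)) /=.
      by rewrite mulrCA.
    have := injnorm_ge t p0 z1; rewrite -/N => zN E.
    have : c^-1 * inner t (pure_tensor z) <= c^-1 * N by rewrite ler_pM2l ?invr_gt0.
    have fin (x1' x2' M w n : R) : x1' - x2' <= w * M ->
        x1' + n * (M * w) <= x2' + (n + 1) * (M * w).
      move=> le12; have -> : (n + 1) * (M * w) = n * (M * w) + w * M by ring.
      by lra.
    by rewrite -E -[m.+1%:R]natr1; exact: (fin _ _ N c^-1 m%:R).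
  have := step r (leqnn r).
  have -> : h 0%N = pure_tensor x by [].
  have -> : h r = pure_tensor y.
    by rewrite /h; congr pure_tensor; apply/funext => k; rewrite ltn_ord.
  have -> : r%:R * (N / (2 * r%:R)) = N / 2 by field; rewrite gt_eqF.
  by have := hB a aN; rewrite -/y; lra.
exact: injnorm_le.
Qed.
End Net.

(** An inclusion-maximal separated subset works: a point of [S] far from all its members could be
    added to it. *)
Lemma separated_net (R : realType) (A : finType) (S : {set A}) (D : A -> A -> R) (e : R) :
  (forall a, D a a <= e) -> (forall a b, D a b = D b a) ->
  exists N : {set A}, [/\ N \subset S,
    forall a b, a \in N -> b \in N -> a != b -> e < D a b &
    forall y, y \in S -> exists2 n, n \in N & D y n <= e].
Proof.
move=> D0 Dsym.
pose P (N : {set A}) := (N \subset S) &&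
  [forall a, forall b, (a \in N) ==> (b \in N) ==> (a != b) ==> (e < D a b)].
have [] := @ex_maxset _ P.
  exists finset.set0; rewrite /P finset.sub0set; apply/forallP => a; apply/forallP => b.
  by rewrite inE.
move=> N /maxsetP[/andP[NS sepN] maxN].
have sep a b : a \in N -> b \in N -> a != b -> e < D a b.
  by move=> aN bN ab; have := forallP (forallP sepN a) b; rewrite aN bN ab.
exists N; split => // y yS.
have [yN|yN] := boolP (y \in N); first by exists y.
apply: contrapT => far.
have far' n : n \in N -> e < D y n.
  by move=> nN; rewrite ltNge; apply/negP => h; apply: far; exists n.
have PyN : P (y |: N).
  apply/andP; split; first by rewrite finset.subUset finset.sub1set yS.
  apply/forallP => a; apply/forallP => b; apply/implyP => /finset.setU1P[->|aN];
    apply/implyP => /finset.setU1P[->|bN]; apply/implyP => ab.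
  - by rewrite eqxx in ab.
  - exact: far'.
  - by rewrite Dsym far'.
  - exact: sep.
by move: yN; rewrite -(maxN _ PyN (finset.subsetUr _ _)) finset.setU11.
Qed.

(** * Entropy of the grid and chaining on it *)

Section GridChaining.
Context {R : realType} {d r : nat}.
Variables (p : R) (G : r.-tuple 'I_d -> r.-tuple 'I_d -> R) (l0 : 'I_d) (sg : nat -> R).
Hypothesis Gsym : forall i j, G i j = G j i.
Hypothesis Gpsd : forall c, 0 <= qform G c.
Hypotheses (d0 : (0 < d)%N) (r0 : (0 < r)%N) (p2 : 2 <= p).
Hypothesis sg0 : forall q, 0 <= sg q.
Hypothesis sgP : forall (S : {set 'I_r}) (x : 'I_r -> 'rV[R]_d),
  (forall k, lpnorm p (x k) <= 1) ->
  partial_trace G l0 S (fun k i => x k 0 i) <= sg #|S| ^+ 2.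

(** The largest Euclidean norm on the l_p unit ball. *)
Definition radius : R := d%:R `^ (2^-1 - p^-1).
(* The term [radius^-1] makes [radius * noise_scale e >= 1], which absorbs the factor 4
   of [packing_bound]. *)
Definition noise_scale (e : R) : R :=
  \sum_(1 <= q < r.+1) (sg q / e) `^ q%:R^-1 + radius^-1.
(** Its square bounds the logarithm of the packing number at scale [e]. The power of 2 comes from
    the noise deviation [2^-(r+2) / noise_scale e]; the factor [r + 2] absorbs the [r] slots and the
    4 of [packing_bound], through [4 <= exp 2] and [r z^2 + 2 <= (r + 2)^2 z^2] for [z >= 1]. *)
Definition ell (e : R) : R := (r%:R + 2) * 2 ^+ (r + 2) * (radius * noise_scale e).

Let dr : (0 : R) < d%:R. Proof. by rewrite ltr0n. Qed.
Let p0 : 0 < p. Proof. by apply: lt_le_trans p2. Qed.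

Lemma radius_gt0 : 0 < radius. Proof. exact: powR_gt0. Qed.

Lemma radius_sqr : radius ^+ 2 = d%:R `^ (1 - 2 / p).
Proof.
rewrite -powR_mulrn ?powR_ge0// -powRrM; congr (_ `^ _).
by field; rewrite gt_eqF.
Qed.

Lemma noise_scale_ge e : radius^-1 <= noise_scale e.
Proof. by rewrite lerDr sumr_ge0// => q _; exact: powR_ge0. Qed.

Lemma radius_noise_ge1 e : 1 <= radius * noise_scale e.
Proof.
have rg := radius_gt0.
by rewrite -(mulfV (lt0r_neq0 rg)) ler_pM2l// noise_scale_ge.
Qed.

Lemma noise_scale_exp e q : 0 < e -> (0 < q <= r)%N -> sg q <= e * noise_scale e ^+ q.
Proof.
move=> e0 /andP[q0 qr]; rewrite -ler_pdivrMl// mulrC.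
have s0 : 0 <= sg q / e by rewrite divr_ge0// ltW.
have -> : sg q / e = ((sg q / e) `^ q%:R^-1) ^+ q.
  by rewrite -powR_mulrn ?powR_ge0// -powRrM mulVf ?pnatr_eq0 -?lt0n// powRr1.
apply: lerXn2r; rewrite ?nnegrE ?powR_ge0//.
  by apply: le_trans (noise_scale_ge e); rewrite invr_ge0 ltW// radius_gt0.
rewrite /noise_scale (big_rem q) /=; last by rewrite mem_index_iota ltnS q0 qr.
rewrite -addrA lerDl addr_ge0//; last by rewrite invr_ge0 ltW// radius_gt0.
by apply: sumr_ge0 => j _; exact: powR_ge0.
Qed.

Lemma ell_ge1 e : 1 <= ell e.
Proof.
rewrite /ell; have h := radius_noise_ge1 e.
have k : (1 : R) <= 2 ^+ (r + 2) by rewrite exprn_ege1// ler1n.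
have rr : (0 : R) <= r%:R by rewrite ler0n.
have k' : (1 : R) <= r%:R + 2 by lra.
exact: (mulr_ege1 (mulr_ege1 k' k) h).
Qed.

Lemma grid_packing (e : R) : 0 < e ->
  exists N : {set {ffun 'I_r * 'I_d -> 'I_((2 * r * d)%N.*2.+1)}},
  [/\ N \subset grid_net d r p, #|N|%:R <= expR (ell e ^+ 2) &
    forall y, y \in grid_net d r p -> exists2 n, n \in N &
      qform G (fun i => pure_tensor (grid_vector y) i - pure_tensor (grid_vector n) i) <= e ^+ 2].
Proof.
move=> e0.
pose D (a b : {ffun 'I_r * 'I_d -> 'I_((2 * r * d)%N.*2.+1)}) : R :=
  qform G (fun i => pure_tensor (grid_vector a) i - pure_tensor (grid_vector b) i).
have D0 a : D a a <= e ^+ 2.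
  rewrite /D /qform big1 ?sqr_ge0// => i _.
  by rewrite big1// => j _; rewrite subrr !mul0r.
have Dsym a b : D a b = D b a.
  rewrite /D; have -> : (fun i => pure_tensor (grid_vector a) i - pure_tensor (grid_vector b) i) =
    (fun i => (- 1) * (pure_tensor (grid_vector b) i - pure_tensor (grid_vector a) i) : R).
    by apply/funext => i; ring.
  by rewrite qform_scale sqrrN expr1n mul1r.
have [N [NS sepN netN]] := separated_net (grid_net d r p) D0 Dsym.
exists N; split => //.
have inN a : a \in N -> forall k, lpnorm p (grid_vector (R := R) a k) <= 1.
  by move=> aN; have := fintype.subsetP NS _ aN; rewrite inE => /asboolP.
set m := noise_scale e; have rg := radius_gt0.
have m0 : 0 < m by apply: lt_le_trans (noise_scale_ge e); rewrite invr_gt0.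
(* One factor [2^r] comes from Cauchy-Schwarz in the noise expansion and another from the number of
   sets [S]; with this [c0] the mean squared displacement is at most [e^2 / 16], below the [e^2 / 8]
   required. *)
pose c0 : R := (2 ^+ (r + 2))^-1.
have c00 : 0 < c0 by rewrite invr_gt0 exprn_gt0.
have c01 : c0 <= 1 by rewrite invf_le1 ?exprn_gt0// exprn_ege1// ler1n.
pose t := c0 / m; have t0 : 0 < t by rewrite divr_gt0.
have ee0 : 0 < e ^+ 2 by rewrite exprn_gt0.
apply: (@le_trans _ _ (4 * expR ((r%:R * radius ^+ 2) / t ^+ 2))).
  apply: (packing_bound (e := e ^+ 2) (l0 := l0)
    (pt := fun a k i => grid_vector a k 0 i) Gsym Gpsd t0 ee0).
  - by move=> a aN k i; exact: lpnorm_coord p0 (inN a aN k).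
  - move=> a aN; rewrite radius_sqr.
    apply: (@le_trans _ _ (\sum_(k < r) d%:R `^ (1 - 2 / p))).
      by apply: ler_sum => k _; exact: sum_sqr_lpnorm d0 p2 (inN a aN k).
    by rewrite sumr_const card_ord -[_ *+ r]mulr_natl.
  - move=> a aN.
    apply: (@le_trans _ _ (2 ^+ r * \sum_(S : {set 'I_r}) (c0 * e) ^+ 2)).
      rewrite ler_wpM2l ?exprn_ge0// [leLHS]big_mkcond; apply: ler_sum => S _.
      rewrite inE; case: ifP => [S0|_]; last exact: sqr_ge0.
      have Sr : (#|S| <= r)%N by rewrite -[X in (_ <= X)%N](card_ord r) max_card.
      apply: (@le_trans _ _ (t ^+ 2 ^+ #|S| * sg #|S| ^+ 2)).
        apply: ler_wpM2l; first by rewrite exprn_ge0 ?sqr_ge0.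
        exact: (sgP S (inN a aN)).
      rewrite exprAC -exprMn; apply: lerXn2r; rewrite ?nnegrE ?mulr_ge0 ?exprn_ge0 ?(ltW t0) ?(ltW c00) ?(ltW e0)//.
      have hq := noise_scale_exp e0 (introT andP (conj S0 Sr)).
      apply: (@le_trans _ _ (t ^+ #|S| * (e * m ^+ #|S|))).
        by rewrite ler_wpM2l ?exprn_ge0// ltW.
      have -> : t ^+ #|S| * (e * m ^+ #|S|) = c0 ^+ #|S| * e.
        rewrite mulrCA -exprMn divfK ?gt_eqF//; ring.
      (* Since [c0 <= 1] and [S] is nonempty, one factor [c0] survives for every [S]. *)
      rewrite ler_pM2r//; move: S0; case: #|S| => // n _.
      by rewrite exprS ler_piMr ?(ltW c00)// exprn_ile1// ltW.
    have -> : \sum_(S : {set 'I_r}) (c0 * e) ^+ 2 = (2 ^+ r) * (c0 * e) ^+ 2.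
      rewrite sumr_const -natrX mulr_natl; congr (_ *+ _).
      by rewrite -cardsT -powersetT card_powerset cardsT card_ord.
    have -> : 2 ^+ r * (2 ^+ r * (c0 * e) ^+ 2) = e ^+ 2 / 16 :> R.
      by rewrite /c0 exprD; field; rewrite expf_neq0.
    by rewrite ler_pM2l// lef_pV2 ?posrE// ler_nat.
  - by move=> a b aN bN ab; exact: sepN.
have e2 : (4 : R) <= expR 2.
  have -> : (2 : R) = 1 + 1 by []; rewrite expRD; have := expR_ge1Dx (1 : R); nra.
apply: (@le_trans _ _ (expR 2 * expR (r%:R * radius ^+ 2 / t ^+ 2))).
  by rewrite ler_pM2r// expR_gt0.
rewrite -expRD ler_expR /ell -/m.
have -> : r%:R * radius ^+ 2 / t ^+ 2 = r%:R * (2 ^+ (r + 2) * (radius * m)) ^+ 2.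
  have pn : (2 : R) ^+ (r + 2) != 0 by rewrite expf_neq0.
  by rewrite /t /c0; move: (2 ^+ (r + 2)) pn => a an; field; rewrite an gt_eqF.
have -> : (r%:R + 2) * 2 ^+ (r + 2) * (radius * m) =
  (r%:R + 2) * (2 ^+ (r + 2) * (radius * m)) by rewrite -[LHS]mulrA.
have : 1 <= 2 ^+ (r + 2) * (radius * m).
  apply: mulr_ege1; last exact: radius_noise_ge1.
  by rewrite exprn_ege1// ler1n.
have : (1 : R) <= r%:R by rewrite ler1n.
move: (2 ^+ _ * _) (r%:R) => z n n1 z1.
have zz : 1 <= z ^+ 2 by rewrite expr2; nra.
rewrite exprMn; nra.
Qed.

Lemma grid_chaining (K : nat) (s0 : R) : 0 < s0 ->
  (forall x : 'I_r -> 'rV[R]_d, (forall k, lpnorm p (x k) <= 1) ->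
     qform G (pure_tensor x) <= s0 ^+ 2) ->
  exists (I : finType) (b : R) (a : I -> R) (C : I -> tensor R d r),
  [/\ 0 <= b, forall i, 0 <= a i,
      forall t, injnorm p t <= 2 * (b + \sum_i a i * expR (inner t (C i))) &
      b + \sum_i a i * expR (qform G (C i) / 2) <=
      \sum_(k < K) 3 / 2 * (s0 / 2 ^+ k) * ell (s0 / 2 ^+ k.+1) +
      3 / 2 * (s0 / 2 ^+ K) * (2 * r * d)%:R].
Proof.
move=> s00 Vs0.
pose gridT := ({ffun 'I_r * 'I_d -> 'I_((2 * r * d)%N.*2.+1)})%type.
have e0 k : 0 < s0 / 2 ^+ k by rewrite divr_gt0// exprn_gt0.
pose Nf k := sval (cid (grid_packing (e0 k))).
have NfP k := svalP (cid (grid_packing (e0 k))).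
have Lt : (2 * r * d < (2 * r * d)%N.*2.+1)%N by rewrite ltnS -addnn leq_addr.
(* All coordinates at the index [L], that is, all vectors zero; since [0 < r] the product tensor
   vanishes. *)
pose a0 : gridT := [ffun => Ordinal Lt].
pose pt (a : gridT) : tensor R d r := pure_tensor (grid_vector a).
have pt0 i : pt a0 i = 0.
  by rewrite /pt /pure_tensor (bigD1 (Ordinal r0))//= mxE ffunE /= subrr !mul0r.
(* Level 0 is the zero tensor, levels 1 to [K] are the separated nets, and level [K + 1] is the
   whole grid, as [injnorm_le_net] demands. *)
pose N (k : nat) : {set gridT} :=
  if k == 0%N then [set a0]%SET else if (k <= K)%N then Nf k else grid_net d r p.
have Nsub k n : n \in N k.+1 -> n \in grid_net d r p.
  by rewrite /N /=; case: ifP => // _; have [/fintype.subsetP h _ _] := NfP k.+1; exact: h.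
have /choice[phi hphi] : forall kn : nat * gridT, exists m, (kn.1 < K.+1)%N ->
    kn.2 \in N kn.1.+1 -> m \in N kn.1 /\
     qform G (fun i => pt kn.2 i - pt m i) <= (s0 / 2 ^+ kn.1) ^+ 2.
  move=> [[|k] n] /=.
    exists a0 => _ /Nsub nS; split; first by rewrite /N inE.
    have -> : (fun i => pt n i - pt a0 i) = pt n.
      by apply/funext => i; rewrite pt0 subr0.
    by rewrite expr0 divr1; apply: Vs0; move: nS; rewrite inE => /asboolP.
  have [kK|kK] := leqP k.+1 K; last by exists a0 => h; have := leq_ltn_trans kK h; rewrite ltnn.
  have [_ _ net] := NfP k.+1.
  have [nS|nS] := boolP (n \in grid_net d r p); last by exists a0 => _ /Nsub nS'; rewrite nS' in nS.
  have [m mN hm] := net _ nS; exists m => _ _; split => //.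
  by rewrite /N /= kK.
pose l k := if (k < K)%N then ell (s0 / 2 ^+ k.+1) else (2 * r * d)%:R : R.
have [||||I [b [a [C [b0 ai0 aN aG]]]]] := @chaining R d r G _ pt N
  (fun k n => phi (k, n)) (fun k => s0 / 2 ^+ k) l a0 K.+1.
- by rewrite /N eqxx.
- exact: pt0.
- move=> k kK; split => //.
    rewrite /l; case: ifP => _; first exact: ell_ge1.
    by rewrite ler1n !muln_gt0 r0 d0.
  rewrite /l /N /=; case: ifP => kK'; first by have [] := NfP k.+1.
  (* With [L = 2 r d] the grid has [(2 L + 1)^(r d) <= exp (2 L r d)] points, and [2 L r d] is
     exactly [(2 r d)^2]; hence the value [2 r d] of [l] at the last link. *)
  apply: (@le_trans _ _ (#|gridT|%:R)); first by rewrite ler_nat max_card.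
  rewrite card_ffun card_prod !card_ord.
  set L := (2 * r * d)%N.
  have h : (L.*2.+1)%:R <= expR (L.*2)%:R :> R.
    by rewrite -natr1 addrC expR_ge1Dx.
  rewrite natrX; apply: (@le_trans _ _ (expR (L.*2)%:R ^+ (r * d))).
    by apply: lerXn2r => //; rewrite nnegrE ?ler0n ?expR_ge0.
  rewrite -expRM_natl ler_expR -natrM -natrX ler_nat /L.
  by rewrite -mul2n; lia.
- by move=> k n kK nN; have := hphi (k, n) kK nN.
exists I, b, a, C; split => //.
  move=> t; apply: (injnorm_le_net d0 r0 p2) => n nS.
  by apply: aN; rewrite /N /= ltnn.
apply: le_trans aG _; rewrite big_ord_recr /= /l ltnn lerD2r.
by apply: ler_sum => k _; rewrite ltn_ord.
Qed.
End GridChaining.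

(** * Summation over dyadic scales *)

Section DyadicSum.
Context {R : realType}.

(** Applied with [b = 1 - 1/q], which is at least [1/2] for [q >= 2]: the common ratio
    [z = 2^(-1/2)] then serves every [q]. *)
Lemma dyadic_powR (z s b : R) (n : nat) : z = 2^-1 `^ 2^-1 -> 0 < s -> 2^-1 <= b ->
  (s / 2 ^+ n) `^ b <= s `^ b * z ^+ n.
Proof.
move=> zE s0 hb; rewrite powRM ?(ltW s0) ?invr_ge0 ?exprn_ge0//.
rewrite ler_pM2l ?powR_gt0// -exprVn.
have -> : (2^-1 ^+ n) `^ b = (2^-1 `^ b) ^+ n :> R.
  by rewrite -!powR_mulrn ?powR_ge0 ?invr_ge0// -!powRrM mulrC.
apply: lerXn2r; rewrite ?nnegrE ?zE ?powR_ge0//.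
apply: ger_powR => //; rewrite invr_gt0 ltr0n /=.
by rewrite invf_le1// ler1n.
Qed.

Lemma geometric_sum_le (z : R) (K : nat) : 0 <= z -> z <= 3 / 4 ->
  \sum_(k < K) z ^+ k.+1 <= 3.
Proof.
move=> z0 z1; suff : \sum_(k < K) z ^+ k.+1 <= 3 * (1 - z ^+ K).
  by have := exprn_ge0 K z0; lra.
elim: K => [|K IH]; first by rewrite big_ord0 expr0 subrr mulr0.
rewrite big_ord_recr /=; have : 0 <= z ^+ K by exact: exprn_ge0.
rewrite exprS; move: (z ^+ K) IH => y IH y0; nra.
Qed.

Lemma sqrt_half_le (z : R) : z = 2^-1 `^ 2^-1 -> z <= 3 / 4.
Proof.
move=> ->; set y := _ `^ _; have y0 : 0 <= y by exact: powR_ge0.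
have yy : y ^+ 2 = 2^-1.
  by rewrite -powR_mulrn// -powRrM mulVf ?pnatr_eq0// powRr1 ?invr_ge0.
by rewrite leNgt; apply/negP => h; nra.
Qed.

Lemma chain_sum_le (d r : nat) (p : R) (sg : nat -> R) (K : nat) (s0 M : R) :
  (0 < d)%N -> (0 < r)%N -> (forall q, 0 <= sg q) -> 0 < s0 -> 0 <= M ->
  (forall q, (2 <= q <= r)%N -> sg q `^ q%:R^-1 * s0 `^ (1 - q%:R^-1) <= M) ->
  \sum_(k < K) 3 / 2 * (s0 / 2 ^+ k) * @ell R d r p sg (s0 / 2 ^+ k.+1) <=
  3 * ((r%:R + 2) * 2 ^+ (r + 2)) * @radius R d p *
    (K%:R * sg 1%N + 3 * (r%:R * M + s0 / @radius R d p)).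
Proof.
move=> d0 r0 sg0 s00 M0 hM.
have rg : 0 < @radius R d p by exact: radius_gt0.
set c := (r%:R + 2) * 2 ^+ (r + 2).
have c0 : 0 <= c by apply: mulr_ge0; [exact: addr_ge0 | exact: exprn_ge0].
pose z : R := 2^-1 `^ 2^-1.
have z0 : 0 <= z by exact: powR_ge0.
have rM0 : 0 <= r%:R * M + s0 / @radius R d p.
  apply: addr_ge0; first by rewrite mulr_ge0.
  by rewrite divr_ge0 ?(ltW s00) ?(ltW rg).
have term k : s0 / 2 ^+ k.+1 * @noise_scale R d r p sg (s0 / 2 ^+ k.+1) <=
    sg 1%N + (r%:R * M + s0 / @radius R d p) * z ^+ k.+1.
  set e := s0 / _; have e0 : 0 < e by rewrite divr_gt0// exprn_gt0.
  rewrite /noise_scale big_ltn ?ltnS// invr1 powRr1 ?divr_ge0 ?(ltW e0)//.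
  rewrite !mulrDr (mulrCA e) divff ?gt_eqF// mulr1 mulrDl -!addrA lerD2l.
  apply: lerD.
    rewrite mulr_sumr.
    apply: (@le_trans _ _ (\sum_(2 <= q < r.+1) M * z ^+ k.+1)).
      rewrite [leLHS]big_nat [leRHS]big_nat; apply: ler_sum => q; rewrite ltnS => q2.
      have q0 : (0 : R) < q%:R by rewrite ltr0n; case/andP: q2 => /ltnW.
      have -> : e * (sg q / e) `^ q%:R^-1 = sg q `^ q%:R^-1 * e `^ (1 - q%:R^-1).
        rewrite powRM ?invr_ge0 ?(ltW e0)// mulrCA; congr (_ * _).
        rewrite (@powRD _ e 1 (- q%:R^-1)); last by rewrite (gt_eqF e0) implybT.
        by rewrite powRr1 ?(ltW e0)// -(powR_inv1 (ltW e0)) -powRrM mulN1r.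
      have hb : 2^-1 <= 1 - q%:R^-1 :> R.
        have : q%:R^-1 <= 2^-1 :> R.
          by rewrite lef_pV2 ?posrE// ler_nat; case/andP: q2.
        by lra.
      have h := dyadic_powR k.+1 (erefl z) s00 hb.
      apply: (@le_trans _ _ (sg q `^ q%:R^-1 * (s0 `^ (1 - q%:R^-1) * z ^+ k.+1))).
        by rewrite ler_wpM2l ?powR_ge0.
      by rewrite mulrA ler_wpM2r ?exprn_ge0// hM.
    rewrite sumr_const_nat -[_ *+ _]mulr_natl mulrA ler_wpM2r ?exprn_ge0//.
    by rewrite ler_wpM2r// ler_nat subSS leq_subr.
  rewrite /e mulrAC; apply: ler_wpM2l.
    by rewrite divr_ge0 ?(ltW s00) ?(ltW rg).
  have h1 : 2^-1 <= 1 :> R by rewrite invf_le1// ler1n.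
  have := dyadic_powR k.+1 (erefl z) ltr01 h1.
  by rewrite powR1 !mul1r powRr1// invr_ge0 exprn_ge0.
  exact: (ltW s00).
apply: (@le_trans _ _ (\sum_(k < K) 3 * c * @radius R d p *
    (sg 1%N + (r%:R * M + s0 / @radius R d p) * z ^+ k.+1))).
  apply: ler_sum => k _.
  (* A link is twice as long as the scale of the net it starts from, so [3/2] becomes 3. *)
  have -> : 3 / 2 * (s0 / 2 ^+ k) * @ell R d r p sg (s0 / 2 ^+ k.+1) =
     3 * c * @radius R d p * (s0 / 2 ^+ k.+1 * @noise_scale R d r p sg (s0 / 2 ^+ k.+1)).
    rewrite /ell -/c; set m := noise_scale _ _ _; rewrite exprS.
    by field; rewrite expf_neq0.
  by rewrite ler_wpM2l// !mulr_ge0 ?(ltW rg).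
rewrite -mulr_sumr big_split /= sumr_const card_ord -[_ *+ K]mulr_natl -mulr_sumr.
rewrite ler_wpM2l ?mulr_ge0 ?(ltW rg)// lerD2l mulrC ler_wpM2r//.
exact: geometric_sum_le z0 (sqrt_half_le (erefl z)).
Qed.
End DyadicSum.

(** * Comparison with the parameters [sigma] and conclusion *)

(** Expand the vectors in the slots of [S] in the standard basis and apply Cauchy-Schwarz; the
    squared weights factor over the slots, each slot of [S] contributing at most [D]. The cases
    [#|S| = 0] and [#|S| = 2] give the two bounds on the variance of the process used in the
    theorem. *)
Lemma qform_le_trace (R : realType) (d r : nat) (G : r.-tuple 'I_d -> r.-tuple 'I_d -> R)
    (l0 : 'I_d) (S : {set 'I_r}) (x : 'I_r -> 'I_d -> R) (D : R) :
  (forall i j, G i j = G j i) -> (forall c, 0 <= qform G c) ->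
  (forall k, \sum_i x k i ^+ 2 <= D) ->
  qform G (tprod x) <= D ^+ #|S| * partial_trace G l0 S x.
Proof.
move=> Gsym Gpsd xD.
pose w k l : R := if k \in S then x k l else (l == l0)%:R.
pose e k l i : R := if k \in S then (i == l)%:R else (l == l0)%:R * x k i.
have -> : tprod x = fun i => \sum_(l : {ffun 'I_r -> 'I_d})
    (\prod_k w k (l k)) * tprod (fun k => e k (l k)) i.
  apply/funext => i; rewrite /tprod.
  under [RHS]eq_bigr do rewrite -big_split /=.
  rewrite -(bigA_distr_bigA (fun k l => w k l * e k l (tnth i k))).
  apply: eq_bigr => k _; rewrite /w /e; case kS: (k \in S).
    rewrite (bigD1 (tnth i k))//= eqxx mulr1 big1 ?addr0// => l.
    by rewrite eq_sym => /negbTE ->; rewrite mulr0.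
  rewrite (bigD1 l0)//= eqxx !mul1r big1 ?addr0// => l.
  by move=> /negbTE ->; rewrite mul0r.
apply: le_trans (qform_wsum_le Gsym Gpsd _ _) _.
rewrite ler_wpM2r ?sumr_ge0//.
under eq_bigr do rewrite -prodrXl.
rewrite -(bigA_distr_bigA (fun k l => w k l ^+ 2)).
have -> : D ^+ #|S| = \prod_(k < r) (if k \in S then D else 1).
  by rewrite -big_mkcond prodr_const.
apply: ler_prod => k _; rewrite sumr_ge0/=; last by move=> l _; exact: sqr_ge0.
rewrite /w; case kS: (k \in S); first exact: xD.
by rewrite (bigD1 l0)//= eqxx expr1n big1 ?addr0// => l /negbTE ->; rewrite expr0n.
Qed.

Lemma partial_trace_sigma (R : realType) (disp : measure_display)
    (Omega : measurableType disp) (P : probability Omega R) (d r : nat)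
    (T : r.-tuple 'I_d -> {RV P >-> R}) (p : R) (l0 : 'I_d) (S : {set 'I_r})
    (x : 'I_r -> 'rV[R]_d) : 0 < p ->
  (forall w, symmetric_tensor (sample T w)) -> jointly_gaussian P T ->
  (forall k, lpnorm p (x k) <= 1) ->
  partial_trace (covT T) l0 S (fun k i => x k 0 i) <= sigma T p (inord #|S|) ^+ 2.
Proof.
move=> p0 sT gT x1; rewrite /sigma sqr_sqrtr ?injnorm_ge0//.
have [s hs] := perm_to_last S.
have Sr : (#|S| < r.+1)%N by rewrite ltnS -[X in (_ <= X)%N](card_ord r) max_card.
rewrite (partial_trace_perm (cov_sym T) (cov_perm sT) l0 (s := s)
  (S' := [set k : 'I_r | (r - (inord #|S| : 'I_r.+1) <= k)%N]%SET)); last first.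
  by move=> k; rewrite hs inE inordK.
have [y [hy ->]] := partial_trace_inner (cov_sym T) (cov_perm sT) l0 (inord #|S|)
  (fun k => x (s k)).
rewrite (mean_star_cov gT); apply: injnorm_ge => // k.
by have [k' ->] := hy k.
Qed.

Lemma expected_injnorm_le (R : realType) (disp : measure_display)
    (Omega : measurableType disp) (P : probability Omega R) (d r : nat)
    (T : r.-tuple 'I_d -> {RV P >-> R}) (p : R) (K : nat) (s0 : R) :
  (0 < d)%N -> (0 < r)%N -> 2 <= p ->
  (forall w, symmetric_tensor (sample T w)) -> jointly_gaussian P T ->
  (forall i, ('E_P[T i] = 0)%E) -> 0 < s0 ->
  (forall x : 'I_r -> 'rV[R]_d, (forall k, lpnorm p (x k) <= 1) ->
     qform (covT T) (pure_tensor x) <= s0 ^+ 2) ->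
  ('E_P[fun w => injnorm p (sample T w)] <=
   (2 * (\sum_(k < K) 3 / 2 * (s0 / 2 ^+ k) *
       @ell R d r p (fun q => sigma T p (inord q)) (s0 / 2 ^+ k.+1) +
      3 / 2 * (s0 / 2 ^+ K) * (2 * r * d)%:R))%:E)%E.
Proof.
move=> d0 r0 p2 sT gT T0 s00 Vs0; have p0 : 0 < p by apply: lt_le_trans p2.
have sg0 q : 0 <= sigma T p (inord q) by exact: sqrtr_ge0.
have sgP (S : {set 'I_r}) (x : 'I_r -> 'rV[R]_d) : (forall k, lpnorm p (x k) <= 1) ->
    partial_trace (covT T) (Ordinal d0) S (fun k i => x k 0 i) <=
    (fun q => sigma T p (inord q)) #|S| ^+ 2.
  exact: partial_trace_sigma.
have [I [b [a [C [b0 a0 hb hG]]]]] := grid_chaining (cov_sym T) (cov_psd gT) d0 r0 p2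
  sg0 sgP K s00 Vs0.
apply: (@le_trans _ _ (2 * b + \sum_i (2 * a i) * expR (qform (covT T) (C i) / 2))%:E).
  apply: (expectation_le_exponentials gT T0).
  - by move=> w; exact: injnorm_ge0.
  - by rewrite mulr_ge0.
  - by move=> i; rewrite mulr_ge0.
  - move=> w; apply: le_trans (hb _) _; rewrite mulrDr mulr_sumr.
    by rewrite lerD2l; apply: ler_sum => i _; rewrite mulrA.
rewrite lee_fin; under eq_bigr do rewrite -mulrA.
by rewrite -mulr_sumr -mulrDr ler_pM2l.
Qed.

(** For [d >= 2] both [up_log 2 d - 1] and 1 are at most [2 ln d], because [ln 2 >= 1/2]. For
    [d = 1] both sides vanish: there are no dyadic levels, in accordance with [log d = 0]. *)
Lemma up_log_le_ln (R : realType) (d : nat) : (0 < d)%N ->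
  (up_log 2 d)%:R <= 4 * ln d%:R :> R.
Proof.
move=> d0; have [d1|d1] := leqP d 1.
  have -> : d = 1%N by lia.
  by rewrite up_log1 ln1 mulr0.
have h : (2 ^ (up_log 2 d).-1 <= d)%N by rewrite ltnW// up_log_gtn.
have k0 : (0 < up_log 2 d)%N by rewrite up_log_gt0.
have ln2 : 2^-1 <= ln 2 :> R.
  have := expR_ge1Dx (- ln (2 : R)); rewrite expRN lnK ?posrE//; lra.
have l1 : ln (2 : R) <= ln d%:R by rewrite ler_ln ?posrE ?ltr0n// ler_nat.
have l2 : (up_log 2 d).-1%:R * ln (2 : R) <= ln d%:R.
  rewrite mulr_natl -lnXn// -natrX ler_ln ?posrE ?ltr0n ?expn_gt0//.
  by rewrite ler_nat.
rewrite -(prednK k0) -[_.+1%:R]natr1.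
have : (0 : R) <= (up_log 2 d).-1%:R by rewrite ler0n.
move: (_.-1%:R) l2 => n l2 n0; nra.
Qed.

Theorem theorem1p6 (R : realType) (r : nat) (p : R) (hr : (2 <= r)%N)
    (hp : 2 <= p) :
  exists C : R, 0 < C /\
    forall (d : nat), (1 <= d)%N ->
    forall (disp : measure_display) (Omega : measurableType disp)
      (P : probability Omega R) (T : r.-tuple 'I_d -> {RV P >-> R}),
      (forall w : Omega, symmetric_tensor (sample T w)) ->
      jointly_gaussian P T ->
      (forall i : r.-tuple 'I_d, ('E_P[T i] = 0)%E) ->
      ((d%:R `^ (p^-1 - 2^-1))%:E * 'E_P[fun w => injnorm p (sample T w)]
        <= (C * (ln d%:R * sigma T p (inord 1)
                 + \big[Num.max/0]_(q < r.+1 | (2 <= q)%N)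
                     (sigma T p q `^ (q%:R^-1)
                      * sigma T p ord0 `^ ((q.-1)%:R / q%:R))))%:E)%E.
Proof.
have r0 : (0 < r)%N by apply: leq_trans hr.
have p0 : 0 < p by apply: lt_le_trans hp.
pose c : R := (r%:R + 2) * 2 ^+ (r + 2).
have c0 : 0 < c by rewrite mulr_gt0 ?exprn_gt0// ltr_wpDl.
have rr : (0 : R) < r%:R by rewrite ltr0n.
(* [24 c] is [2 * 3 * 4 c]: grid rounding, chaining sum, and [K <= 4 ln d] levels. The part
   [18 c (r + 1)] is the geometric series, and [6 r] is the last link. *)
exists (24 * c + (18 * (c * (r%:R + 1)) + 6 * r%:R)).
have C0 : 0 < c * (r%:R + 1) by rewrite mulr_gt0// addr_gt0.
split; first by lra.
move=> d d0 disp Omega P T sT gT T0.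
set M := \big[_/_]_(q < _ | _) _.
have M0 : 0 <= M by exact: bigmax_ge_id.
pose sg q := sigma T p (inord q).
have sg0 q : 0 <= sg q by exact: sqrtr_ge0.
have rg : 0 < @radius R d p := radius_gt0 p d0.
pose rho := @radius R d p; rewrite -/rho in rg.
have ln0 : 0 <= ln d%:R :> R by rewrite ln_ge0// ler1n.
have -> : d%:R `^ (p^-1 - 2^-1) = rho^-1 by rewrite /rho /radius -powRN opprB.
have sgE : sigma T p ord0 = sg 0%N.
  by rewrite /sg; congr (sigma T p _); apply: val_inj; rewrite /= inordK.
have xrho (x : 'I_r -> 'rV[R]_d) : (forall k, lpnorm p (x k) <= 1) ->
    forall k, \sum_i x k 0 i ^+ 2 <= rho ^+ 2.
  by move=> x1 k; rewrite /rho radius_sqr //; exact: sum_sqr_lpnorm.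
have V0 (x : 'I_r -> 'rV[R]_d) : (forall k, lpnorm p (x k) <= 1) ->
    qform (covT T) (pure_tensor x) <= sg 0%N ^+ 2.
  move=> x1.
  apply: le_trans (qform_le_trace (Ordinal d0) finset.set0 (cov_sym T) (cov_psd gT) (xrho x x1)) _.
  rewrite cards0 expr0 mul1r.
  have := partial_trace_sigma (Ordinal d0) finset.set0 p0 sT gT x1.
  by rewrite cards0.
have V2 (x : 'I_r -> 'rV[R]_d) : (forall k, lpnorm p (x k) <= 1) ->
    qform (covT T) (pure_tensor x) <= (rho ^+ 2 * sg 2) ^+ 2.
  move=> x1; pose S : {set 'I_r} := [set Ordinal r0; Ordinal hr]%SET.
  have S2 : #|S| = 2 by rewrite cards2.
  apply: le_trans (qform_le_trace (Ordinal d0) S (cov_sym T) (cov_psd gT) (xrho x x1)) _.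
  rewrite S2 [leRHS]exprMn ler_pM2l ?exprn_gt0//.
  by have := partial_trace_sigma (Ordinal d0) S p0 sT gT x1; rewrite S2.
(* Starting the chain at [s1] rather than at [sigma_0] makes it at most [rho * M], which the extra
   term [s1 / rho] of the chaining sum and the last link both require. Both members of the minimum
   bound the standard deviation of the process. *)
pose s1 := Num.min (sg 0%N) (rho ^+ 2 * sg 2).
have Vs1 (x : 'I_r -> 'rV[R]_d) : (forall k, lpnorm p (x k) <= 1) ->
    qform (covT T) (pure_tensor x) <= s1 ^+ 2.
  by move=> x1; rewrite /s1 minEle; case: ifP => _; [exact: (V0 x x1) | exact: (V2 x x1)].
have s10 : 0 <= s1 by rewrite le_min sg0 mulr_ge0// exprn_ge0// ltW.
have E0 : (0 <= 'E_P[fun w => injnorm p (sample T w)])%E.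
  by apply: expectation_ge0 => w; exact: injnorm_ge0.
have B0 : 0 <= ln d%:R * sg 1%N + M by rewrite addr_ge0// mulr_ge0.
(* If [s1 = 0] the process has variance zero: a single link of arbitrarily small scale. *)
have [s1z|s1p] := eqVneq s1 0.
  suff Ele : ('E_P[fun w => injnorm p (sample T w)] <= 0)%E.
    apply: (@le_trans _ _ 0%E); last by rewrite lee_fin mulr_ge0//; lra.
    by rewrite mule_ge0_le0// lee_fin invr_ge0 ltW.
  apply/lee_addgt0Pr => e e0; rewrite add0e.
  have rd0 : (0 : R) < r%:R * d%:R by rewrite mulr_gt0// ltr0n.
  (* With [K = 0] the bound is [2 * (3/2) * s0 * 2 r d = 6 r d s0], which is exactly [e]. *)
  pose s0 : R := e / (6 * (r%:R * d%:R)).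
  have s00 : 0 < s0 by rewrite divr_gt0// mulr_gt0.
  have Vs0 (x : 'I_r -> 'rV[R]_d) : (forall k, lpnorm p (x k) <= 1) ->
      qform (covT T) (pure_tensor x) <= s0 ^+ 2.
    by move=> x1; apply: le_trans (Vs1 x x1) _; rewrite s1z expr0n sqr_ge0.
  have := expected_injnorm_le 0 d0 r0 hp sT gT T0 s00 Vs0.
  rewrite big_ord0 add0r expr0 divr1.
  have -> // : 2 * (3 / 2 * s0 * (2 * r * d)%:R) = e :> R.
  by rewrite /s0 !natrM; field; rewrite !gt_eqF// ltr0n.
have s1g : 0 < s1 by rewrite lt_neqAle eq_sym s1p.
have hM q : (2 <= q <= r)%N -> sg q `^ q%:R^-1 * s1 `^ (1 - q%:R^-1) <= M.
  move=> /andP[q2 qr]; have q1 : (0 < q)%N by apply: leq_trans q2.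
  have qn : q%:R != 0 :> R by rewrite pnatr_eq0 -lt0n.
  have h := @le_bigmax_cond _ _ _ 0 (inord q : 'I_r.+1) (fun q => (2 <= q)%N)
    (fun q : 'I_r.+1 => sigma T p q `^ q%:R^-1 * sigma T p ord0 `^ (q.-1%:R / q%:R)).
  move: h; rewrite inordK ?ltnS// => /(_ q2); apply: le_trans.
  rewrite sgE -/(sg q) ler_wpM2l ?powR_ge0//.
  have -> : q.-1%:R / q%:R = 1 - q%:R^-1 :> R.
    by rewrite -[in LHS]subn1 natrB// mulrBl mul1r divff.
  (* The exponent [1 - 1/q] is nonnegative, so [s1 <= sigma_0] may be used. *)
  apply: ge0_ler_powR; rewrite ?nnegrE//.
    by rewrite subr_ge0 invf_le1 ?ler1n// ltr0n.
  by rewrite /s1 ge_min lexx.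
(* One square root of [s1] is bounded by [rho * sigma_2^(1/2)], the other is kept; their product is
   [rho] times the term [q = 2] of the maximum. *)
have s1M : s1 <= rho * M.
  have h2 := hM 2 (introT andP (conj (leqnn 2) hr)).
  have half : 1 - 2^-1 = 2^-1 :> R by field.
  rewrite half in h2.
  have sq : s1 = s1 `^ 2^-1 * s1 `^ 2^-1.
    rewrite -(@powRD _ s1 2^-1 2^-1); last by rewrite (gt_eqF s1g) implybT.
    have -> : 2^-1 + 2^-1 = 1 :> R by field.
    by rewrite powRr1.
  have : s1 `^ 2^-1 <= rho * sg 2 `^ 2^-1.
    apply: (@le_trans _ _ ((rho ^+ 2 * sg 2) `^ 2^-1)).
      apply: ge0_ler_powR; rewrite ?nnegrE ?invr_ge0// ?mulr_ge0 ?exprn_ge0 ?(ltW rg)//.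
      by rewrite /s1 ge_min lexx orbT.
    rewrite powRM ?exprn_ge0 ?(ltW rg)// -powR_mulrn ?(ltW rg)// -powRrM divff ?pnatr_eq0//.
    by rewrite powRr1 ?(ltW rg).
  move=> h3; rewrite {1}sq; apply: le_trans (_ : rho * sg 2 `^ 2^-1 * s1 `^ 2^-1 <= _).
    by rewrite ler_wpM2r ?powR_ge0.
  by rewrite -mulrA ler_pM2l.
(* Deep enough for [2^K >= d], which cancels the factor [d] of the crude last link, while [K] stays
   of order [log d]. *)
pose K := up_log 2 d.
have Kln : K%:R <= 4 * ln d%:R :> R := up_log_le_ln R d0.
have dK : d%:R <= 2 ^+ K :> R by rewrite -natrX ler_nat up_logP.
apply: le_trans (lee_wpmul2l _ (expected_injnorm_le K d0 r0 hp sT gT T0 s1g Vs1)) _.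
  by rewrite lee_fin invr_ge0 ltW.
rewrite -EFinM lee_fin -/(sg 1%N).
have := @chain_sum_le R d r p sg K s1 M d0 r0 sg0 s1g M0 hM.
rewrite -/c -/rho; set B := \sum_(k < K) _ => hB.
have hL : 3 / 2 * (s1 / 2 ^+ K) * (2 * r * d)%:R <= 3 * r%:R * (rho * M).
  have -> : 3 / 2 * (s1 / 2 ^+ K) * (2 * r * d)%:R = 3 * r%:R * (s1 * (d%:R / 2 ^+ K)).
    by rewrite !natrM; field; rewrite expf_neq0.
  rewrite ler_pM2l ?mulr_gt0//; apply: le_trans s1M.
  by rewrite ler_piMr ?(ltW s1g)// ler_pdivrMr ?exprn_gt0// mul1r.
have s1r : s1 / rho <= M by rewrite ler_pdivrMr// mulrC.
rewrite ler_pdivrMl//.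
have hB2 : B <= rho * (3 * c * (4 * (ln d%:R * sg 1%N) + 3 * ((r%:R + 1) * M))).
  apply: le_trans hB _.
  rewrite [leLHS](_ : _ = rho * (3 * c * (K%:R * sg 1%N + 3 * (r%:R * M + s1 / rho)))); last by ring.
  rewrite ler_pM2l// ler_pM2l ?mulr_gt0//.
  have : K%:R * sg 1%N <= 4 * ln d%:R * sg 1%N by rewrite ler_wpM2r.
  by lra.
have lsg : 0 <= ln d%:R * sg 1%N by rewrite mulr_ge0.
apply: (@le_trans _ _ (rho * (2 * (3 * c * (4 * (ln d%:R * sg 1%N) + 3 * ((r%:R + 1) * M)) + 3 * r%:R * M)))).
  by move: hL hB2; rewrite mulrCA => hL hB2; lra.
rewrite ler_pM2l//; move: lsg; set X := ln _ * _ => X0.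
rewrite -subr_ge0.
have -> : (24 * c + (18 * (c * (r%:R + 1)) + 6 * r%:R)) * (X + M) -
  2 * (3 * c * (4 * X + 3 * ((r%:R + 1) * M)) + 3 * r%:R * M) =
  24 * c * M + (18 * (c * (r%:R + 1)) + 6 * r%:R) * X by ring.
by rewrite addr_ge0// mulr_ge0//; lra.
Qed.
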